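(* Let $M$ be a closed algebraic submanifold of $\mathbb{R}^n$ and $f$ a generic linear functional on $\mathbb{R}^n$. Suppose that $f|_M$ does not have any critical value in the interval $[a,b]$. Then the sets $M_{\le a}$ and $M_{\le b}$ have the same homotopy type.
   Context: $M_{\le a}=\{x\in M\mid f(x)\le a\}$. A critical value of $f|_M$ is a value attained at some point $p\in M$ with $d(f|_M)(p)=0$. ''Generic'' means: for all linear functionals outside a subset of measure zero (depending on $M$) of the space of linear functionals on $\mathbb{R}^n$. *)

(* Defs.v *)
From HB Require Import structures.
From mathcomp Require Import all_boot all_order all_algebra.
(* The notations of mpoly clash with those of MathComp-Analysis. *)
From mathcomp Require Import -(notations) mpoly.
From mathcomp Require Import all_classical all_reals all_analysis.

Set Implicit Arguments.
Unset Strict Implicit.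
Unset Printing Implicit Defensive.

Import Order.TTheory GRing.Theory Num.Theory.
Import numFieldNormedType.Exports.

Local Open Scope classical_set_scope.
Local Open Scope ring_scope.

Section Smooth.
Variables (R : realType) (V W : normedModType R).

(* Meaningful for [U] open: 'D_v g x depends only on the germ of [g] at [x]. *)
Fixpoint Ck_on (k : nat) (U : set V) (g : V -> W) : Prop :=
  if k is k'.+1 then
    (forall x, U x -> differentiable g x) /\
    (forall v, Ck_on k' U (fun x => 'D_v g x))
  else forall x, U x -> {for x, continuous g}.

Definition smooth_on (U : set V) (g : V -> W) : Prop := forall k, Ck_on k U g.

End Smooth.

Section Submanifold.
Variables (R : realType) (n : nat).
Implicit Types M : set 'rV[R]_n.

Definition algebraic_set M : Prop :=
  exists ps : seq (mpoly n R),
    M = [set x | all (fun p => meval (fun i => x 0 i) p == 0) ps].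

(* Around each point of M there is a diffeomorphism phi : U -> W between open
   subsets of R^n, with inverse psi, such that phi(U `&` M) is the
   intersection of W with the coordinate subspace R^d x {0}. *)
Definition submanifold (d : nat) M : Prop :=
  (d <= n)%N /\
  forall p, M p -> exists (U W : set 'rV[R]_n) (phi psi : 'rV[R]_n -> 'rV[R]_n),
    [/\ open U /\ U p, open W,
        smooth_on U phi /\ smooth_on W psi,
        [/\ set_fun U W phi, set_fun W U psi,
            {in U, cancel phi psi} & {in W, cancel psi phi}]
      & forall x, U x -> (M x <-> forall i : 'I_n, (d <= i)%N -> phi x 0 i = 0)].

(* An algebraic set is automatically closed; [closed M] is kept for
   readability. *)
Definition closed_algebraic_submanifold (d : nat) M : Prop :=
  [/\ closed M, algebraic_set M & submanifold d M].

(* The tangent space of M at p, as velocities of smooth curves in M. *)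
Definition tangent_space M (p : 'rV[R]_n) : set 'rV[R]_n :=
  [set v | exists (e : R) (c : R^o -> 'rV[R]_n),
    [/\ 0 < e, smooth_on `]-e, e[ c, (forall t, t \in `]-e, e[ -> M (c t)),
        c 0 = p & 'D_1 c 0 = v]].

(* For g differentiable at p in M, the differential of g restricted to M is
   the restriction of 'd g p to the tangent space of M at p. *)
Definition critical_point (g : 'rV[R]_n -> R^o) M (p : 'rV[R]_n) : Prop :=
  M p /\ forall v, tangent_space M p v -> 'd g p v = 0.

Definition critical_value (g : 'rV[R]_n -> R^o) M (c : R) : Prop :=
  exists2 p, critical_point g M p & g p = c.

Definition sublevel (g : 'rV[R]_n -> R^o) M (a : R) : set 'rV[R]_n :=
  [set x | M x /\ (g x : R) <= a].

End Submanifold.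

Section Generic.
Variables (R : realType) (n : nat).

(* Lebesgue-null subsets of R^n: for every e > 0 there is a countable (possibly
   finite, whence the index set D) cover by closed boxes of total volume < e. *)
Definition lebesgue_null (A : set 'rV[R]_n) : Prop :=
  forall e : R, 0 < e ->
    exists (D : set nat) (l u : nat -> 'rV[R]_n),
      [/\ forall k, D k -> forall i, l k 0 i <= u k 0 i,
          A `<=` \bigcup_(k in D) [set x | forall i, l k 0 i <= x 0 i <= u k 0 i]
        & (\esum_(k in D) (\prod_(i < n) (u k 0 i - l k 0 i))%:E < e%:E)%E].

(* The linear isomorphism from the dual of R^n to R^n given by the dual basis. *)
Definition functional_coords (f : {linear 'rV[R]_n -> R^o}) : 'rV[R]_n :=
  \row_i f (delta_mx 0 i).

Definition generic_functional (P : {linear 'rV[R]_n -> R^o} -> Prop) : Prop :=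
  exists N : set {linear 'rV[R]_n -> R^o},
    lebesgue_null (functional_coords @` N) /\ forall f, ~ N f -> P f.

End Generic.

Section Homotopy.
Variables (R : realType) (T U : topologicalType).

Definition maps_into (A : set T) (B : set U) (f : T -> U) : Prop :=
  set_fun A B f /\ {within A, continuous f}.

Definition homotopic (A : set T) (B : set U) (f g : T -> U) : Prop :=
  exists H : R * T -> U,
    [/\ {within `[0, 1] `*` A, continuous H},
        set_fun (`[0, 1] `*` A) B H,
        forall x, A x -> H (0, x) = f x & forall x, A x -> H (1, x) = g x].

End Homotopy.

(* Maps between the subspaces A and B are represented by total functions, of
   which only the restrictions matter. *)
Definition homotopy_equivalent (R : realType) (T U : ptopologicalType)
    (A : set T) (B : set U) : Prop :=
  exists (f : T -> U) (g : U -> T),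
    [/\ maps_into A B f, maps_into B A g,
        homotopic R A A (g \o f) id & homotopic R B B (f \o g) id].

(* Main.v *)
(* Proximal normals: nu is a proximal normal at x (prox_normal) when, up to a
   quadratic error, x minimises nu . y for y in M; on a submanifold this forces
   nu to be orthogonal to the tangent space.

   Genericity.  The pairs (nu, |x|^2), with nu proximal normal at x, form a subset
   of R^(n+1) that is first-order definable and is a countable union of Lipschitz
   images of subsets of R^n, hence has empty interior.  By quantifier elimination
   a polynomial Q(nu, r) <> 0 vanishes on it.  Where the leading coefficient q(nu)
   of Q in r does not vanish, the roots r are locally bounded: for nu' close to nu,
   the points where nu' is normal to M stay in a fixed ball.  The zero set of q is
   the exceptional null set.

   Deformation.  For such a functional nu, gradient flow is replaced by proximal
   steps: x is sent to the point of M nearest to x - h(x) nu, which is unique and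
   depends continuously on x as soon as h(x) is small.  A step decreases the
   functional, strictly at noncritical points, and far away the decrease controls
   the displacement; so the iterates of a point of M_b reach M_a, after a number
   of steps that is locally bounded. *)
Require Import Defs.
From HB Require Import structures.
From mathcomp Require Import all_boot all_order all_algebra.
From mathcomp Require Import all_classical all_reals all_analysis.
From mathcomp Require Import ring lra zify.
From mathcomp Require Import -(notations) mpoly ordered_qelim qe_rcf polyrcf.
Import Order.TTheory GRing.Theory Num.Theory.
Import numFieldNormedType.Exports.
Local Open Scope classical_set_scope.
Local Open Scope ring_scope.

Set Implicit Arguments.
Unset Strict Implicit.
Unset Printing Implicit Defensive.

(** * Dot product and continuity *)

(** As M may be noncompact, the absence of critical values does not by itself confine a descent: it
    could drift to infinity while the functional hardly decreases. What excludes this is that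
    vectors at distance less than some [d] from [nu] are proximal normals only at points of a fixed
    ball, so that a step ending far away must be long compared with its parameter h. Algebraicity is
    used exactly there: the extra coordinate |x|^2 turns a bound on the feet of normals into a bound
    on the roots of a polynomial. Proximal normals are chosen for two reasons: their definition
    contains no derivative, which makes it first-order, and every nearest point yields one without
    any computation in a chart. Charts serve only locally, for the uniqueness of nearest points and
    for the dimension count. Norms of row vectors are sup norms, whereas [dot] is Euclidean; the
    factors [n%:R] come from comparing the two. *)

Lemma continuous_atP (R : realType) (V W : normedModType R) (f : V -> W) (x : V) :
  {for x, continuous f} <-> forall e : R, 0 < e ->
    exists2 d : R, 0 < d & forall y, `|x - y| < d -> `|f x - f y| < e.
Proof.
split=> [/cvgrPdist_lt fx e e0|fx].
  have /nbhs_ballP[d d0 dx] := fx _ e0; exists d => // y xy.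
  by apply: dx; rewrite -ball_normE.
apply/cvgrPdist_lt => e /fx[d d0 dx]; apply/nbhs_ballP; exists d => // y.
by rewrite -ball_normE /= => /dx.
Qed.

Lemma continuous_pair (T U V : topologicalType) (f : T -> U) (g : T -> V) (x : T) :
  {for x, continuous f} -> {for x, continuous g} ->
  {for x, continuous (fun y => (f y, g y))}.
Proof. by move=> fx gx; exact: cvg_pair. Qed.

Lemma continuous_at_sum (R : realType) (T : topologicalType) (I : Type)
    (r : seq I) (F : I -> T -> R) (x : T) :
  (forall i, {for x, continuous (F i)}) ->
  {for x, continuous (fun y => \sum_(i <- r) F i y)}.
Proof.
move=> Fx; apply: cvg_big => [|i _]; last exact: Fx.
exact: add_continuous.
Qed.

Lemma within_comp (T U V : topologicalType) (A : set T) (B : set U)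
    (f : T -> U) (g : U -> V) : {within A, continuous f} -> set_fun A B f ->
  {within B, continuous g} -> {within A, continuous (g \o f)}.
Proof.
move=> /subspace_continuousP fc AB /subspace_continuousP gc.
apply/subspace_continuousP => x Ax W /(gc _ (AB _ Ax)) fW.
have H : nbhs x [set y | A y -> B (f y) -> W (g (f y))] := fc _ Ax _ fW.
suff : nbhs x [set y | A y -> W (g (f y))] by [].
by move: H; apply: filterS => y H Ay; exact: H Ay (AB _ Ay).
Qed.

Lemma lipschitz_continuous (R : realType) (V W : normedModType R) (f : V -> W) (c : R) :
  (forall x y, `|f x - f y| <= c * `|x - y|) -> continuous f.
Proof.
move=> fc x; apply/continuous_atP => e e0.
have c1 : 0 < `|c| + 1 by rewrite ltr_wpDl.
exists (e / (`|c| + 1)); first by rewrite divr_gt0.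
move=> y xy.
apply: (le_lt_trans (fc _ _)).
apply: (@le_lt_trans _ _ ((`|c| + 1) * `|x - y|)).
  by rewrite ler_wpM2r// (le_trans (ler_norm c))// lerDl.
by rewrite mulrC -ltr_pdivlMr.
Qed.

Section Dot.
Variables (R : realType) (n : nat).
Implicit Types u v w x y : 'rV[R]_n.

Definition dot u v : R := \sum_i u 0 i * v 0 i.

Lemma dotC u v : dot u v = dot v u.
Proof. by apply: eq_bigr => i _; rewrite mulrC. Qed.

Lemma dotDl u v w : dot (u + v) w = dot u w + dot v w.
Proof. by rewrite -big_split; apply: eq_bigr => i _; rewrite !mxE mulrDl. Qed.

Lemma dotZl c u v : dot (c *: u) v = c * dot u v.
Proof. by rewrite mulr_sumr; apply: eq_bigr => i _; rewrite !mxE mulrA. Qed.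

Lemma dotNl u v : dot (- u) v = - dot u v.
Proof. by rewrite -scaleN1r dotZl mulN1r. Qed.

Lemma dotBl u v w : dot (u - v) w = dot u w - dot v w.
Proof. by rewrite dotDl dotNl. Qed.

Lemma dotDr u v w : dot w (u + v) = dot w u + dot w v.
Proof. by rewrite !(dotC w) dotDl. Qed.

Lemma dotZr c u v : dot v (c *: u) = c * dot v u.
Proof. by rewrite !(dotC v) dotZl. Qed.

Lemma dotNr u v : dot v (- u) = - dot v u.
Proof. by rewrite !(dotC v) dotNl. Qed.

Lemma dotBr u v w : dot w (u - v) = dot w u - dot w v.
Proof. by rewrite !(dotC w) dotBl. Qed.

Lemma dot0l u : dot 0 u = 0.
Proof. by rewrite -(scale0r 0) dotZl mul0r. Qed.

Lemma dot0r u : dot u 0 = 0. Proof. by rewrite dotC dot0l. Qed.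

Lemma dot_sumr I (r : seq I) (P : pred I) (F : I -> 'rV[R]_n) u :
  dot u (\sum_(i <- r | P i) F i) = \sum_(i <- r | P i) dot u (F i).
Proof. by apply: (big_morph (dot u)) => [v w|]; rewrite ?dotDr ?dot0r. Qed.

Lemma dot_delta u i : dot u (delta_mx 0 i) = u 0 i.
Proof.
rewrite /dot (bigD1 i)//= big1 ?addr0 => [|j /negPf ji].
  by rewrite mxE !eqxx mulr1.
by rewrite mxE ji andbF mulr0.
Qed.

Lemma coord_le_norm x i : `|x 0 i| <= `|x|.
Proof.
rewrite [leRHS]/Num.norm /= mx_normrE; apply/bigmax_geP; right => /=.
by exists (0, i).
Qed.

Lemma norm_le_coord x (e : R) : 0 <= e -> (forall i, `|x 0 i| <= e) -> `|x| <= e.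
Proof.
move=> e0 H; rewrite [leLHS]/Num.norm /= mx_normrE; apply/bigmax_leP; split => //.
by move=> [i j] _ /=; rewrite ord1.
Qed.

Lemma norm_lt_coord x (e : R) : 0 < e -> (forall i, `|x 0 i| < e) -> `|x| < e.
Proof.
move=> e0 H; rewrite [ltLHS]/Num.norm /= mx_normrE; apply/bigmax_ltP; split => //.
by move=> [i j] _ /=; rewrite ord1.
Qed.

Lemma norm_le_dot x : `|x| ^+ 2 <= dot x x.
Proof.
have [x0|[i _ xi]] : `|x| = 0 \/ exists2 i : 'I_n, true & `|x| = `|x 0 i|.
  have [->|/eqP xN0] := eqVneq `|x| 0; [by left|right].
  have [] := @mx_norm_neq0 _ _ _ x; first exact/eqP.
  by move=> [i j] /= xij; exists j => //; rewrite [LHS]xij ord1.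
- rewrite x0 expr0n/=; apply: sumr_ge0 => i _; exact: sqr_ge0.
rewrite xi real_normK ?num_real// /dot (bigD1 i)//= expr2 lerDl.
by apply: sumr_ge0 => j _; exact: sqr_ge0.
Qed.

Lemma dot_ge0 x : 0 <= dot x x.
Proof. by apply: le_trans (norm_le_dot x); exact: sqr_ge0. Qed.

Lemma dot_le_norm u v : `|dot u v| <= n%:R * `|u| * `|v|.
Proof.
apply: (le_trans (ler_norm_sum _ _ _)).
have -> : n%:R * `|u| * `|v| = \sum_(i < n) (`|u| * `|v|).
  by rewrite sumr_const card_ord -mulrA mulr_natl.
by apply: ler_sum => i _; rewrite normrM ler_pM// coord_le_norm.
Qed.

Lemma dot_eq0 x : dot x x = 0 -> x = 0.
Proof.
move=> x0; apply/eqP; rewrite -normr_eq0 -sqrf_eq0 eq_le sqr_ge0 andbT -x0.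
exact: norm_le_dot.
Qed.

Lemma linear_dot u (f : {linear 'rV[R]_n -> R^o}) :
  f u = dot (functional_coords f) u.
Proof.
rewrite {1}(row_sum_delta u) linear_sum; apply: eq_bigr => i _.
by rewrite linearZ !mxE mulrC.
Qed.

Lemma dot_continuous u : continuous (dot u).
Proof.
apply: (@lipschitz_continuous _ _ _ _ (n%:R * `|u|)) => x y.
by rewrite -dotBr dot_le_norm.
Qed.

End Dot.

(** * Nearest points *)

Section NearestPoint.
Variables (R : realType) (n : nat) (M : set 'rV[R]_n).
Implicit Types u v x y p q nu : 'rV[R]_n.

Definition nearest y p :=
  M p /\ forall q, M q -> dot (p - y) (p - y) <= dot (q - y) (q - y).

Definition uniquely_nearest y :=
  forall p q, nearest y p -> nearest y q -> p = q.

Definition proj y : 'rV[R]_n := get (nearest y).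

(* In the usual terminology, it is - nu that is a proximal normal to M at x. *)
Definition prox_normal nu x := M x /\
  exists C : R, forall y, M y -> 0 <= dot nu (y - x) + C * dot (y - x) (y - x).

Lemma dist_continuous y : continuous (fun p : 'rV[R]_n => dot (p - y) (p - y)).
Proof.
have -> : (fun p => dot (p - y) (p - y)) =
    (fun p => \sum_i ((p 0 i - y 0 i) * (p 0 i - y 0 i))).
  by apply/funext => p; apply: eq_bigr => i _; rewrite !mxE.
apply: (@continuous_big _ _ +%R 0 predT add_continuous) => i _.
have c : continuous (fun p : 'rV[R]_n => p 0 i - y 0 i).
  move=> p; apply: continuousB; first exact: coord_continuous.
  exact: cst_continuous.
by move=> p; exact: (continuousM (c p) (c p)).
Qed.

Lemma bounded_ball_compact (A : set 'rV[R]_n) (B : R) :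
  closed A -> compact (A `&` [set x | `|x| <= B]).
Proof.
move=> cA; apply: bounded_closed_compact.
  exists B; split; first exact: num_real.
  by move=> e Be x [_ /= xB]; apply: (le_trans xB); exact: ltW.
apply: closedI => //.
apply: (@closed_comp _ _ (fun x : 'rV[R]_n => `|x|) [set x | x <= B]).
  by move=> x _; exact: norm_continuous.
exact: closed_le.
Qed.

Lemma nearest_exists y q : closed M -> M q -> exists p, nearest y p.
Proof.
move=> cM Mq.
(* Outside the ball of radius [B], points are at distance at least A + 1 from y, where A = n |q -
   y|^2 bounds the squared distance from y to q; and A <= (A + 1)^2. *)
pose B := n%:R * `|q - y| * `|q - y| + 1 + `|y| + `|q|.
have B0 : 0 <= n%:R * `|q - y| * `|q - y| by rewrite !mulr_ge0.
have far p : B < `|p| -> dot (q - y) (q - y) <= dot (p - y) (p - y).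
  move=> Bp; apply: le_trans (norm_le_dot _).
  apply: (le_trans (ler_norm _)); apply: (le_trans (dot_le_norm _ _)).
  have p1 : n%:R * `|q - y| * `|q - y| + 1 <= `|p - y|.
    by have := lerB_dist p y; have := normr_ge0 q; rewrite /B in Bp; lra.
  by move: B0 p1; move: (_ * _ * _) => A; nra.
have qB : `|q| <= B by rewrite /B; have := normr_ge0 y; lra.
have [] := @EVT_min_rV _ _ (fun p => dot (p - y) (p - y))
  (M `&` [set x | `|x| <= B]).
- by exists q.
- exact: bounded_ball_compact.
- by apply: continuous_subspaceT; exact: dist_continuous.
move=> p; rewrite inE => -[Mp /= pB] H; exists p; split=> // r Mr.
have [rB|Br] := leP `|r| B; first by apply: H; rewrite inE.
by apply: le_trans (far _ Br); apply: H; rewrite inE; split.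
Qed.

Lemma projP y q : closed M -> M q -> nearest y (proj y).
Proof. by move=> cM /(nearest_exists y cM)[p yp]; apply: getPex; exists p. Qed.

Lemma proj_id x : M x -> proj x = x.
Proof.
move=> Mx; have xx : nearest x x.
  by split => // q Mq; rewrite subrr dot0l; exact: dot_ge0.
have [_ /(_ _ Mx)] : nearest x (proj x) by apply: getPex; exists x.
rewrite subrr dot0l => H.
by apply/eqP; rewrite -subr_eq0; apply/eqP/dot_eq0/eqP; rewrite eq_le H dot_ge0.
Qed.


Lemma dot_sqrB u v : dot (u - v) (u - v) = dot u u - 2 * dot u v + dot v v.
Proof. by rewrite !(dotBl, dotBr) (dotC v u); ring. Qed.

Lemma dot_sqrD u v : dot (u + v) (u + v) = dot u u + 2 * dot u v + dot v v.
Proof. by rewrite !(dotDl, dotDr) (dotC v u); ring. Qed.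

(* A point close to y has its nearest points in a fixed ball, on which the
   distances to M vary little. *)
Lemma proj_continuous y q : closed M -> M q -> uniquely_nearest y ->
  {for y, continuous proj}.
Proof.
move=> cM Mq uy.
have near_proj z := projP z cM Mq.
set p0 := proj y; have [Mp0 minp0] := near_proj y; rewrite -/p0 in minp0.
have [N n1 dN] : exists2 N : R, 0 < N &
    forall u v, `|dot u v| <= N * `|u| * `|v|.
  exists (n%:R + 1) => [|u v]; first by rewrite ltr_wpDl.
  by apply: (le_trans (dot_le_norm _ _)); rewrite -!mulrA ler_wpM2r ?mulr_ge0// lerDl.
have n0 := ltW n1.
pose c := `|p0 - y| + 1; have c1 : 1 <= c by rewrite lerDr.
pose B := (N + 1) * c + 1.
have near_bound z : `|z - y| < 1 -> `|proj z - y| <= B.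
  move=> zy; have [_ /(_ _ Mp0)] := near_proj z.
  move=> /(le_trans (norm_le_dot _)) pz.
  have {}pz : `|proj z - z| ^+ 2 <= ((N + 1) * c) ^+ 2.
    apply: (le_trans pz); apply: (le_trans (ler_norm _)).
    apply: (le_trans (dN _ _)).
    have : `|p0 - z| <= c.
      rewrite (_ : p0 - z = (p0 - y) - (z - y)).
        by apply: (le_trans (ler_normB _ _)); rewrite /c lerD2l ltW.
      by rewrite opprB addrA subrK.
    move=> p0z; rewrite exprMn -mulrA.
    apply: ler_pM; rewrite ?mulr_ge0 ?expr2//; first by have := mulr_ge0 n0 n0; lra.
    by apply: ler_pM.
  have Nc0 : 0 <= (N + 1) * c by apply: mulr_ge0; lra.
  rewrite ler_sqr ?nnegrE // in pz.
  rewrite (_ : proj z - y = (proj z - z) + (z - y)); last by rewrite addrA subrK.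
  by apply: (le_trans (ler_normD _ _)); rewrite /B lerD// ltW.
apply/continuous_atP => e e0.
pose K := M `&` [set p | `|p| <= B + `|y|] `&` [set p | e <= `|p - p0|].
have cK : compact K.
  apply: subclosed_compact (@bounded_ball_compact M (B + `|y|) cM) _.
    apply: closedI.
      by apply: compact_closed; [exact: norm_hausdorff|exact: bounded_ball_compact].
    apply: (@closed_comp _ _ (fun x : 'rV[R]_n => `|x - p0|) [set x | e <= x]).
      move=> x _; apply: (@lipschitz_continuous _ _ _ _ 1) => u v.
      by rewrite mul1r (le_trans (ler_dist_dist _ _))// opprB addrA subrK.
    exact: closed_ge.
  by move=> x [].
have [d [d0 Kd]] : exists d : R, 0 < d /\
    forall p, K p -> dot (p0 - y) (p0 - y) + d <= dot (p - y) (p - y).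
  have [K0|] := pselect (K !=set0); last first.
    by move=> K0; exists 1; split => // p Kp; exfalso; apply: K0; exists p.
  have [p1] := EVT_min_rV K0 cK (continuous_subspaceT (@dist_continuous y)).
  rewrite inE => -[[Mp1 _] /= ep1] minp1.
  exists (dot (p1 - y) (p1 - y) - dot (p0 - y) (p0 - y)); split; last first.
    by move=> p Kp; rewrite addrC subrK minp1// inE.
  rewrite subr_gt0 lt_neqAle minp0// andbT; apply/eqP => eq01.
  have p01 : p1 = p0.
    by apply: uy => //; split=> // q' Mq'; rewrite -eq01 minp0.
  by move: ep1; rewrite p01 subrr normr0 leNgt e0.
have B0 : 0 < 2 * (N * (2 * B + 1)).
  have : 0 <= (N + 1) * c by apply: mulr_ge0; lra.
  by move=> ?; rewrite !mulr_gt0// /B; lra.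
pose eta := Num.min 1 (d / (2 * (N * (2 * B + 1)))).
exists eta; first by rewrite lt_min ltr01 divr_gt0.
move=> z; rewrite lt_min => /andP[yz1 yzd].
rewrite distrC ltNge; apply/negP => epz.
have pzB := near_bound z; rewrite distrC in pzB; have {}pzB := pzB yz1.
have [Mpz minpz] := near_proj z.
have vary p : `|p - y| <= B ->
    `|dot (p - y) (p - y) - dot (p - z) (p - z)| < d / 2.
  move=> pB.
  have -> : dot (p - y) (p - y) - dot (p - z) (p - z) =
      dot (z - y) (2 *: (p - y) + (y - z)).
    have -> : p - z = (p - y) - (z - y) by rewrite opprB addrA subrK.
    rewrite -(opprB z y); move: (p - y) (z - y) => u v.
    by rewrite dot_sqrB dotDr dotZr dotNr (dotC v u); ring.
  apply: (le_lt_trans (dN _ _)).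
  have : `|2 *: (p - y) + (y - z)| <= 2 * B + 1.
    apply: (le_trans (ler_normD _ _)); rewrite normrZ normr_nat.
    by apply: lerD; [lra|exact: ltW].
  rewrite distrC in yzd; rewrite ltr_pdivlMr// in yzd => H.
  have H2 : N * `|z - y| * `|2 *: (p - y) + (y - z)| <=
     N * `|z - y| * (2 * B + 1) by rewrite ler_wpM2l// mulr_ge0.
  by apply: (le_lt_trans H2); move: yzd; set t := `|z - y|; nra.
have Kpz : K (proj z).
  split=> //; split => //=; have := lerB_dist (proj z) y; lra.
have := Kd _ Kpz; have := vary _ pzB.
have p0B : `|p0 - y| <= B.
  by have := mulr_ge0 n0 (le_trans ler01 c1); rewrite /B /c; lra.
have := vary _ p0B; have := minpz _ Mp0.
rewrite !ltr_norml; lra.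
Qed.

(** First-order condition for the minimum of |q - (x - h nu)|^2 over q in M, read off by expanding
    the square around p. The deviation from [nu] is the displacement divided by h, which
    [step_fixed] and [step_displacement] both exploit. *)
Lemma nearest_prox_normal x p nu (h : R) : 0 < h -> nearest (x - h *: nu) p ->
  prox_normal (nu + h^-1 *: (p - x)) p.
Proof.
move=> h0 [Mp minp]; split=> //; exists (2 * h)^-1 => q /minp.
have -> : p - (x - h *: nu) = (p - x) + h *: nu by rewrite opprB addrCA addrC.
have -> : q - (x - h *: nu) = (q - p) + ((p - x) + h *: nu).
  by rewrite opprB !addrA subrK addrAC.
have e : dot (q - p) (p - x + h *: nu) = dot (p - x) (q - p) + h * dot nu (q - p).
  by rewrite dotC dotDl dotZl.
rewrite (dot_sqrD (q - p)) e [dot (nu + _) _]dotDl dotZl => H.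
rewrite -(pmulr_rge0 _ (_ : 0 < 2 * h)) ?mulr_gt0//.
have -> : 2 * h * (dot nu (q - p) + h^-1 * dot (p - x) (q - p) +
   (2 * h)^-1 * dot (q - p) (q - p)) = 2 * h * dot nu (q - p)
   + 2 * dot (p - x) (q - p) + dot (q - p) (q - p) by field; lra.
by lra.
Qed.

Lemma nearest_decrease x p nu (h : R) : M x -> nearest (x - h *: nu) p ->
  2 * h * dot nu p + dot (p - x) (p - x) <= 2 * h * dot nu x.
Proof.
move=> Mx [_ /(_ _ Mx)].
have -> : p - (x - h *: nu) = (p - x) + h *: nu by rewrite opprB addrCA addrC.
rewrite opprB addrCA subrr addr0 dot_sqrD [dot (p - x) (h *: nu)]dotZr.
by rewrite (dotC (p - x) nu) [dot nu (p - x)]dotBr; lra.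
Qed.

End NearestPoint.

(** * Gauges *)

(* The least upper bound of the radii on which [P] is satisfied is a 1-Lipschitz
   function of the centre. *)
Lemma gauge (R : realType) (V : normedModType R) (A : set V) (P : R -> V -> Prop) :
  (forall s t x, P t x -> 0 < s <= t -> P s x) ->
  (forall x, A x -> exists2 s, 0 < s & forall y, A y -> `|x - y| < s -> P s y) ->
  exists g : V -> R, [/\ continuous g, forall x, A x -> 0 < g x &
    forall x, A x -> P (g x) x].
Proof.
move=> Pdown Ploc.
(* The cap 1 bounds the set, and the guard [0 < s] puts 0 in it even for centres outside [A]; so the
   supremum is defined and 1-Lipschitz on the whole space. *)
pose E x := [set s : R | 0 <= s <= 1 /\
  (0 < s -> forall y, A y -> `|x - y| < s -> P s y)].
have E0 x : E x 0 by split; rewrite ?lexx ?ler01 ?ltxx.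
have supE x : has_sup (E x).
  by split; [exists 0|exists 1 => s [/andP[]]].
have sup0 x : 0 <= sup (E x) by exact: sup_upper_bound (supE x) _ (E0 x).
have suplip x z : sup (E x) - `|x - z| <= sup (E z).
  rewrite lerBlDr; apply: ge_sup; first by exists 0.
  move=> s [/andP[s0 s1] Es]; rewrite -lerBlDr.
  have [s'0|s'0] := leP (s - `|x - z|) 0; first exact: le_trans (sup0 z).
  apply: (sup_upper_bound (supE z)); split.
    by rewrite (ltW s'0) lerBlDr (le_trans s1)// lerDl.
  move=> _ y Ay zy.
  have ss' : 0 < s - `|x - z| <= s by rewrite s'0 gerBl normr_ge0.
  apply: (Pdown _ _ _ _ ss'); apply: Es => //.
    by apply: lt_le_trans s'0 _; rewrite gerBl normr_ge0.
  by rewrite (le_lt_trans (ler_distD z _ _))// addrC -ltrBrDr.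
have supA x : A x -> 0 < sup (E x).
  move=> Ax; have [s s0 Ps] := Ploc _ Ax.
  have m0 : 0 < Num.min 1 s by rewrite lt_min ltr01.
  apply: (lt_le_trans m0); apply: (sup_upper_bound (supE x)); split.
    by rewrite (ltW m0) ge_min lexx.
  move=> _ y Ay; rewrite lt_min => /andP[_ xy].
  by apply: (Pdown _ _ _ (Ps _ Ay xy)); rewrite m0 ge_min lexx orbT.
(* The supremum need not be attained; half of it lies below some element of [E x], and [Pdown]
   applies. *)
exists (fun x => sup (E x) / 2); split.
- apply: (@lipschitz_continuous _ _ _ _ 1) => x y /=.
  have := suplip x y; have := suplip y x; rewrite (distrC y x) mul1r => H1 H2.
  by rewrite ler_norml; apply/andP; split; lra.
- by move=> x /supA; rewrite pmulr_lgt0.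
- move=> x Ax; have g0 := supA _ Ax.
  have /(sup_adherent)-/(_ _ (supE x))[s Es] : 0 < sup (E x) / 2 by lra.
  rewrite {1}(splitr (sup (E x))) addrK => ls.
  have s0 : 0 < s by lra.
  case: Es => _ /(_ s0 _ Ax); rewrite subrr normr0 => /(_ s0) Psx.
  by apply: (Pdown _ _ _ Psx); rewrite divr_gt0//= ltW.
Qed.

Definition clamp (R : realType) (t : R) : R := Num.max 0 (Num.min 1 t).

Lemma clamp_continuous (R : realType) : continuous (@clamp R).
Proof.
apply: (@lipschitz_continuous _ R R _ 1) => x y; rewrite mul1r /clamp.
rewrite /Num.max /Num.min; case: ifP; case: ifP; case: ifP; case: ifP => *;
  rewrite ler_norml; have := ler_norm (x - y); have := ler_norm (- (x - y));
  rewrite normrN => *; apply/andP; split; lra.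
Qed.

Lemma clamp_itv (R : realType) (t : R) : 0 <= clamp t <= 1.
Proof. by rewrite /clamp le_max lexx/= ge_max ler01 ge_min lexx. Qed.

Lemma clamp1 (R : realType) (t : R) : 1 <= t -> clamp t = 1.
Proof. by move=> t1; rewrite /clamp min_l// max_r// ler01. Qed.

Lemma clamp0 (R : realType) (t : R) : t <= 0 -> clamp t = 0.
Proof. by move=> t0; rewrite /clamp max_l// ge_min t0 orbT. Qed.

(** * Deformation by proximal steps *)

Section Descent.
Variables (R : realType) (n : nat) (M : set 'rV[R]_n) (nu : 'rV[R]_n).
Variables (h : 'rV[R]_n -> R).
Hypotheses (cM : closed M) (hc : continuous h) (h0 : forall x, M x -> 0 < h x).
Hypothesis hu : forall x, M x -> forall t, 0 <= t <= 1 ->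
  uniquely_nearest M (x - (t * h x) *: nu).
Implicit Types (x : 'rV[R]_n) (t : R).

(* The proximal step: it minimises nu . y + |y - x|^2 / (2 t h(x)) over M. *)
Definition step (p : R * 'rV[R]_n) : 'rV[R]_n :=
  proj M (p.2 - (p.1 * h p.2) *: nu).

Lemma step_in t x : M x -> M (step (t, x)).
Proof. by move=> Mx; have [] := projP (x - (t * h x) *: nu) cM Mx. Qed.

Lemma step0 x : M x -> step (0, x) = x.
Proof. by move=> Mx; rewrite /step /= mul0r scale0r subr0 proj_id. Qed.

Lemma step_decrease t x : M x -> 0 <= t ->
  2 * (t * h x) * dot nu (step (t, x)) +
  dot (step (t, x) - x) (step (t, x) - x) <= 2 * (t * h x) * dot nu x.
Proof.
by move=> Mx t0; apply: (nearest_decrease Mx); exact: projP Mx.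
Qed.

Lemma step_le t x : M x -> 0 <= t -> dot nu (step (t, x)) <= dot nu x.
Proof.
move=> Mx; rewrite le_eqVlt => /predU1P[<-|t0]; first by rewrite step0.
have th : 0 < 2 * (t * h x) by rewrite !mulr_gt0// h0.
rewrite -(ler_pM2l th); apply: le_trans (step_decrease Mx (ltW t0)).
by rewrite lerDl dot_ge0.
Qed.

Lemma step_continuous t x : M x -> 0 <= t <= 1 -> {for (t, x), continuous step}.
Proof.
move=> Mx t01.
apply: (@continuous_comp _ _ _ (fun p : R * 'rV[R]_n => p.2 - (p.1 * h p.2) *: nu)
  (proj M) (t, x)); last by apply: (proj_continuous cM Mx); exact: hu.
have c1 : {for (t, x), continuous (fun p : R * 'rV[R]_n => p.1)}.
  exact: cvg_fst.
have c2 : {for (t, x), continuous (fun p : R * 'rV[R]_n => p.2)}.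
  exact: cvg_snd.
apply: continuousB; first exact: c2.
apply: (@continuousZl _ _ _ (fun p : R * 'rV[R]_n => p.1 * h p.2)).
apply: continuousM; first exact: c1.
by apply: (@continuous_comp _ _ _ (fun p : R * 'rV[R]_n => p.2) h); [exact: c2|exact: hc].
Qed.

(** Without decrease, [step_decrease] leaves no room for a displacement: x is the chosen nearest
    point to x - h nu, and the correction term of [nearest_prox_normal] vanishes. *)
Lemma step_fixed x : M x -> dot nu x <= dot nu (step (1, x)) -> prox_normal M nu x.
Proof.
move=> Mx Hx; have := step_decrease Mx ler01; rewrite mul1r => Hd.
have hx := h0 Mx.
have xx : step (1, x) = x.
  apply/eqP; rewrite -subr_eq0; apply/eqP/dot_eq0/eqP.
  rewrite eq_le dot_ge0 andbT.
  have : 2 * h x * dot nu x <= 2 * h x * dot nu (step (1, x)).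
    by rewrite ler_wpM2l//; lra.
  lra.
have := nearest_prox_normal hx (projP (x - h x *: nu) cM Mx).
have -> : proj M (x - h x *: nu) = x by rewrite -[RHS]xx /step /= mul1r.
by rewrite subrr scaler0 addr0.
Qed.

(** The end point p carries the proximal normal nu + (p - x) / h. As p is far, this differs from
    [nu] by at least [d], so |p - x| >= d h; inserted in |p - x|^2 <= 2 h (decrease), this cancels h
    and leaves a bound independent of the step size. *)
Lemma step_displacement x (d B : R) : M x ->
  (forall nu' y, `|nu' - nu| < d -> prox_normal M nu' y -> dot y y <= B) ->
  B < dot (step (1, x)) (step (1, x)) ->
  d * `|step (1, x) - x| <= 2 * (dot nu x - dot nu (step (1, x))).
Proof.
move=> Mx dB far; have hx := h0 Mx.
have := nearest_prox_normal hx (projP (x - h x *: nu) cM Mx).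
have -> : proj M (x - h x *: nu) = step (1, x) by rewrite /step /= mul1r.
set p := step (1, x) => pp.
have dle : d <= (h x)^-1 * `|p - x|.
  rewrite leNgt; apply/negP => dlt; have : dot p p <= B.
    apply: dB pp.
    by rewrite addrC addKr normrZ gtr0_norm// invr_gt0.
  by rewrite leNgt far.
have {}dle : d * h x <= `|p - x| by rewrite mulrC -ler_pdivlMl.
have := step_decrease Mx ler01; rewrite mul1r -/p => Hd.
have := norm_le_dot (p - x) => Hn.
have {}Hn : `|p - x| ^+ 2 <= 2 * h x * (dot nu x - dot nu p) by lra.
rewrite -(ler_pM2l hx); apply: (@le_trans _ _ (`|p - x| ^+ 2)); last lra.
by rewrite mulrA (mulrC (h x)) expr2 ler_wpM2r.
Qed.

Definition iterate k x := iter k (fun y => step (1, y)) x.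

Lemma iterate_in k x : M x -> M (iterate k x).
Proof. by move=> Mx; elim: k => //= k IH; exact: step_in. Qed.

Lemma iterate_continuous k x : M x -> {for x, continuous (iterate k)}.
Proof.
move=> Mx; elim: k => [|k IH]; first exact: cvg_id.
apply: (@continuous_comp _ _ _ (iterate k) (fun y => step (1, y))) => //.
apply: (@continuous_comp _ _ _ (fun y => (1 : R, y)) step).
  by apply: continuous_pair; [exact: cst_continuous|exact: cvg_id].
by apply: step_continuous; [exact: iterate_in|rewrite ler01 lexx].
Qed.

(** If the iterates stayed above [a], their total decrease would be at most b - a. By
    [step_displacement] they would remain in a compact part of M, where the decrease of a step has a
    positive minimum, and finitely many steps would exhaust b - a. *)
Lemma iterate_descends (a b d B : R) x : 0 < d ->
  (forall nu' y, `|nu' - nu| < d -> prox_normal M nu' y -> dot y y <= B) ->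
  (forall y, M y -> a <= dot nu y <= b -> ~ prox_normal M nu y) ->
  M x -> dot nu x <= b -> exists k, dot nu (iterate k x) < a.
Proof.
move=> d0 dB ncrit Mx xb; apply: contrapT => /forallNP hi.
have {}hi k : a <= dot nu (iterate k x) by rewrite leNgt; exact/negP/hi.
have lo k : dot nu (iterate k x) <= dot nu x.
  elim: k => //= k IH; apply: le_trans IH; apply: step_le => //.
  exact: iterate_in.
(* As B1 >= 1, a sup norm above [B1] forces [dot y y] above [B]. The bound [bnd] charges a step to
   the decrease only when it ends outside the ball of radius [B1]. *)
pose B1 := Num.max `|x| (Num.max B 1).
have bnd k : d * `|iterate k x| <= d * B1 + 2 * (dot nu x - dot nu (iterate k x)).
  elim: k => [|k IH] /=.
    by rewrite subrr mulr0 addr0 ler_wpM2l ?(ltW d0)// le_max lexx.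
  set y := iterate k x in IH *; have My : M y by exact: iterate_in.
  have yle : dot nu (step (1, y)) <= dot nu x by exact: (lo k.+1).
  have [ys|ys] := leP `|step (1, y)| B1.
    have := ler_wpM2l (ltW d0) ys; lra.
  have ysB : B < dot (step (1, y)) (step (1, y)).
    apply: lt_le_trans (norm_le_dot _).
    have BB : B <= B1 by rewrite !le_max lexx !orbT.
    have B11 : 1 <= B1 by rewrite !le_max lexx !orbT.
    nra.
  have := step_displacement My dB ysB => disp.
  have tri : `|step (1, y)| <= `|step (1, y) - y| + `|y|.
    by rewrite (le_trans _ (ler_normD _ _))// subrK.
  have := ler_wpM2l (ltW d0) tri; lra.
pose B2 := B1 + 2 / d * (b - a).
pose K := M `&` [set y | `|y| <= B2] `&` [set y | a <= dot nu y]
  `&` [set y | dot nu y <= b].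
have inK k : K (iterate k x).
  split; last exact: le_trans (lo k) _.
  split; last exact: hi.
  split; first exact: iterate_in.
  rewrite /= -(ler_pM2l d0) /B2 mulrDr; apply: (le_trans (bnd k)).
  rewrite lerD2l mulrA [d * _]mulrC divfK ?gt_eqF//.
  by rewrite ler_wpM2l//; have := hi k; lra.
have cK : compact K.
  apply: subclosed_compact (@bounded_ball_compact _ _ M B2 cM) _; last first.
    by move=> y [[[]]].
  have cd : continuous (dot nu) := @dot_continuous _ _ nu.
  apply: closedI; last first.
    by apply: (@closed_comp _ _ (dot nu) [set t | t <= b]);
      [move=> z _; exact: cd|exact: closed_le].
  apply: closedI; last first.
    by apply: (@closed_comp _ _ (dot nu) [set t | a <= t]);
      [move=> z _; exact: cd|exact: closed_ge].
  by apply: compact_closed; [exact: norm_hausdorff|exact: bounded_ball_compact].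
have K0 : K !=set0 by exists x; exact: (inK 0%N).
pose g y := dot nu y - dot nu (step (1, y)).
have cg : {within K, continuous g}.
  apply: continuous_in_subspaceT => y; rewrite inE => -[[[My _] _] _].
  apply: continuousB; first exact: dot_continuous.
  apply: (@continuous_comp _ _ _ (fun y => step (1, y)) (dot nu)).
    exact: (@iterate_continuous 1).
  exact: dot_continuous.
have [y + ymin] := EVT_min_rV K0 cK cg; rewrite inE => -[[[My _] /= ya] yb].
have g0 : 0 < g y.
  rewrite subr_gt0 ltNge; apply/negP => /(step_fixed My).
  by apply: ncrit => //; rewrite ya yb.
have dec k : dot nu (iterate k x) <= b - k%:R * g y.
  elim: k => [|k IH]; first by rewrite mul0r subr0.
  have := ymin (iterate k x); rewrite inE => /(_ (inK k)); rewrite {2}/g /=.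
  by rewrite -natr1; lra.
have ba0 : 0 <= (b - a) / g y.
  by rewrite divr_ge0 ?(ltW g0)// subr_ge0 (le_trans (hi 0%N)).
have := archi_boundP ba0; rewrite ltr_pdivrMr// => Hk.
have := dec (Num.bound ((b - a) / g y)); have := hi (Num.bound ((b - a) / g y)).
by lra.
Qed.

Definition weight (tau : 'rV[R]_n -> R) m x : R := clamp (tau x - m%:R).

(* At time s the first steps are performed with the fractions s, ..., s and
   s * (tau x - floor(tau x)), and the following ones with the fraction 0. *)
Fixpoint flow tau m (p : R * 'rV[R]_n) : 'rV[R]_n :=
  if m is m'.+1 then step (p.1 * weight tau m' p.2, flow tau m' p) else p.2.

Lemma weight_itv tau m x (s : R) : 0 <= s <= 1 -> 0 <= s * weight tau m x <= 1.
Proof.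
move=> /andP[s0 s1]; have /andP[w0 w1] := clamp_itv (tau x - m%:R).
by rewrite mulr_ge0//= mulr_ile1.
Qed.

Lemma flow_in tau m s x : M x -> M (flow tau m (s, x)).
Proof. by move=> Mx; elim: m => //= m IH; exact: step_in. Qed.

Lemma flow_mono tau m k s x : M x -> 0 <= s <= 1 -> (m <= k)%N ->
  dot nu (flow tau k (s, x)) <= dot nu (flow tau m (s, x)).
Proof.
move=> Mx s01; elim: k => [|k IH]; first by rewrite leqn0 => /eqP->.
rewrite leq_eqVlt => /predU1P[->//|]; rewrite ltnS => /IH; apply: le_trans => /=.
apply: step_le; first exact: flow_in.
by have /andP[] := weight_itv tau k x s01.
Qed.

Lemma flow0 tau m x : M x -> flow tau m (0, x) = x.
Proof. by move=> Mx; elim: m => //= m ->; rewrite mul0r step0. Qed.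

Lemma flow_iterate tau m x : m%:R <= tau x -> flow tau m (1, x) = iterate m x.
Proof.
elim: m => [//|m IH mt].
have w1 : weight tau m x = 1 by rewrite /weight clamp1// lerBrDr addrC natr1.
rewrite [LHS]/= w1 mulr1 IH//; apply: le_trans mt; by rewrite ler_nat.
Qed.

Lemma flow_stationary tau m k s x : M x -> tau x <= m%:R -> (m <= k)%N ->
  flow tau k (s, x) = flow tau m (s, x).
Proof.
move=> Mx tm; elim: k => [|k IH]; first by rewrite leqn0 => /eqP->.
rewrite leq_eqVlt => /predU1P[->//|]; rewrite ltnS => mk /=.
have -> : weight tau k x = 0.
  by rewrite /weight clamp0// subr_le0 (le_trans tm)// ler_nat.
by rewrite mulr0 IH// step0//; exact: flow_in.
Qed.

(** The number of steps is immaterial once it is at least [tau x]; so one number can be used near a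
    point, although its choice depends on the point. *)
Lemma flow_eq tau m k s x : M x -> tau x <= m%:R -> tau x <= k%:R ->
  flow tau m (s, x) = flow tau k (s, x).
Proof.
move=> Mx tm tk; have [mk|km] := leqP m k.
  by rewrite -(flow_stationary s Mx tm mk).
by rewrite (flow_stationary s Mx tk (ltnW km)).
Qed.

Lemma flow_continuous tau m s x : M x -> 0 <= s <= 1 ->
  {for x, continuous tau} -> {for (s, x), continuous (flow tau m)}.
Proof.
move=> Mx s01 tc; elim: m => [|m IH] /=; first exact: cvg_snd.
apply: (@continuous_comp _ _ _
  (fun p : R * 'rV[R]_n => (p.1 * weight tau m p.2, flow tau m p)) step); last first.
  by apply: step_continuous; [exact: flow_in|exact: weight_itv].
apply: continuous_pair => //.
apply: continuousM; first exact: cvg_fst.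
apply: (@continuous_comp _ _ _ (fun p : R * 'rV[R]_n => p.2) (weight tau m)).
  exact: cvg_snd.
apply: (@continuous_comp _ _ _ (fun y => tau y - m%:R) (@clamp R)).
  by apply: continuousB => //; exact: cst_continuous.
exact: clamp_continuous.
Qed.

End Descent.

(** * Deformation of the larger sublevel set into the smaller *)

Section Deformation.
Variables (R : realType) (n : nat) (M : set 'rV[R]_n) (nu : 'rV[R]_n).
Variables (a b d B : R).
Hypotheses (cM : closed M) (ab : a <= b).
Hypothesis uM : forall x, M x -> exists2 r : R, 0 < r &
  forall y, `|y - x| < r -> uniquely_nearest M y.
Hypotheses (d0 : 0 < d) (dB : forall nu' y, `|nu' - nu| < d ->
  prox_normal M nu' y -> dot y y <= B).
Hypothesis ncrit : forall y, M y -> a <= dot nu y <= b -> ~ prox_normal M nu y.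

Let Ma := [set x | M x /\ dot nu x <= a].
Let Mb := [set x | M x /\ dot nu x <= b].

(** The radii of uniqueness in [uM] are local; [gauge] turns them into a continuous step size. *)
Lemma step_size : exists h : 'rV[R]_n -> R, [/\ continuous h,
  forall x, M x -> 0 < h x & forall x, M x -> forall t, 0 <= t <= 1 ->
    uniquely_nearest M (x - (t * h x) *: nu)].
Proof.
pose P (s : R) x := forall t, 0 <= t <= s -> uniquely_nearest M (x - t *: nu).
have [||h [hc h0 hP]] := @gauge R _ M P.
- move=> s t x Pt /andP[s0 st] r /andP[r0 rs]; apply: Pt.
  by rewrite r0 (le_trans rs).
- move=> x /uM[r r0 ru].
  (* Half of r pays for |y - x|, the other half for t |nu|, as t <= r / c. *)
  pose c := 2 * (`|nu| + 1); have c0 : 0 < c by rewrite mulr_gt0// ltr_wpDl.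
  exists (Num.min (r / 2) (r / c)); first by rewrite lt_min !divr_gt0.
  move=> y My; rewrite lt_min => /andP[xy _] t /andP[t0].
  rewrite le_min => /andP[_ tr]; apply: ru.
  rewrite addrAC (le_lt_trans (ler_normB _ _))// normrZ ger0_norm//.
  rewrite distrC in xy; rewrite ler_pdivlMr// in tr.
  have n0 := normr_ge0 nu; rewrite /c in tr; nra.
exists h; split => // x Mx t /andP[t0 t1]; apply: hP => //.
by rewrite mulr_ge0 ?(ltW (h0 _ Mx))//= ler_piMl// ltW// h0.
Qed.

(** Being strictly below [a] after k steps is an open condition, so [gauge] applies to [P], in which
    s stands for the inverse of a number of steps. Hence [tau], the inverse of the gauge, is
    continuous on [Mb] and bounds from above some number of steps that brings x below [a]. *)
Lemma deformation : exists H : R * 'rV[R]_n -> 'rV[R]_n,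
  [/\ {within `[0, 1] `*` Mb, continuous H},
      forall s x, 0 <= s <= 1 -> M x -> M (H (s, x)) /\ dot nu (H (s, x)) <= dot nu x,
      forall x, M x -> H (0, x) = x & forall x, Mb x -> Ma (H (1, x))].
Proof.
have [h [hc h0 hu]] := step_size.
pose S := iterate M nu h.
pose P (s : R) x := exists2 k, k%:R <= s^-1 & dot nu (S k x) < a.
have [||sg [sgc sg0 sgP]] := @gauge R _ Mb P.
- move=> s t x [k kt Sa] /andP[s0 st]; exists k => //.
  by rewrite (le_trans kt)// lef_pV2// ?posrE// (lt_le_trans s0).
- move=> x [Mx xb].
  have [k Sk] := iterate_descends cM hc h0 hu d0 dB ncrit Mx xb.
  have kc : {for x, continuous (fun y => dot nu (S k y))}.
    apply: (@continuous_comp _ _ _ (S k) (dot nu)).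
      exact: (iterate_continuous cM hc hu).
    exact: dot_continuous.
  have e0 : 0 < a - dot nu (S k x) by rewrite subr_gt0.
  have [r r0 Hr] := (continuous_atP _ _).1 kc _ e0.
  (* A radius s at most 1 / (k + 1) ensures k <= 1 / s; the successor avoids inverting 0. *)
  exists (Num.min r (k.+1%:R)^-1); first by rewrite lt_min r0 invr_gt0 ltr0Sn.
  move=> y [My _]; rewrite lt_min => /andP[yr _]; exists k.
    rewrite (@le_trans _ _ k.+1%:R)// ?ler_nat//.
    rewrite -[leLHS]invrK lef_pV2 ?posrE ?invr_gt0 ?lt_min ?r0 ?invr_gt0 ?ltr0Sn//.
    by rewrite ge_min lexx orbT.
  have := Hr _ yr; rewrite ltr_norml => /andP[H1 H2]; lra.
pose tau x := (sg x)^-1.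
pose N x := (Num.bound `|tau x|).+1.
have tauN x : tau x <= (N x)%:R.
  apply: (le_trans (ler_norm _)); apply: ltW; apply: (lt_trans (archi_boundP _)) => //.
  by rewrite ltr_nat.
pose H p := flow M nu h tau (N p.2) p.
exists H; split.
- apply/subspace_continuousP => -[s x] [/= s01 [Mx xb]].
  rewrite in_itv /= in s01.
  have tc : {for x, continuous tau} by apply: continuousV; rewrite ?gt_eqF ?sg0//; exact: sgc.
  (* [N] may jump, but where [tau] differs from [tau x] by less than 1, the constant [m] bounds
     [tau], and [H] coincides there with the continuous flow of [m] steps. *)
  pose m := (N x).+1.
  have taumx : tau x <= m%:R by rewrite (le_trans (tauN x))// ler_nat.
  have mx : flow M nu h tau m (s, x) = H (s, x).
    by rewrite /H (@flow_eq _ _ M nu h cM tau m (N x) s x Mx taumx (tauN x)).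
  have fc := @flow_continuous _ _ M nu h cM hc hu tau m s x Mx s01 tc.
  apply/cvgrPdist_lt => e e0.
  have [r r0 Hr] := (continuous_atP _ _).1 fc _ e0.
  have [r' r'0 Hr'] := (continuous_atP _ _).1 tc _ ltr01.
  apply/nbhs_ballP; exists (Num.min r r'); first by rewrite /= lt_min r0.
  move=> [t y]; rewrite -ball_normE /= lt_min => /andP[yr yr'] [/= t01 [My yb]].
  have xy : `|x - y| < r' by apply: le_lt_trans yr'; rewrite le_max lexx orbT.
  have taum : tau y <= m%:R.
    have := Hr' _ xy; have := tauN x; rewrite /m -natr1 ltr_norml; lra.
  change (`|H (s, x) - H (t, y)| < e).
  have -> : H (t, y) = flow M nu h tau m (t, y).
    exact: (@flow_eq _ _ M nu h cM tau (N y) m t y My (tauN y) taum).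
  by rewrite -mx; exact: Hr.
- move=> s x s01 Mx; split; first exact: flow_in.
  exact: (@flow_mono _ _ M nu h cM h0 tau 0 (N x)).
- by move=> x Mx; exact: flow0.
- move=> x [Mx xb]; split; first exact: flow_in.
  have [k kt Sk] := sgP x (conj Mx xb).
  have kN : (k <= N x)%N by rewrite -(ler_nat R) (le_trans kt)//; exact: tauN.
  have s01 : 0 <= (1 : R) <= 1 by rewrite ler01 lexx.
  apply: (le_trans (@flow_mono _ _ M nu h cM h0 tau k (N x) 1 x Mx s01 kN)).
  by rewrite flow_iterate//; exact: ltW.
Qed.

(** As [H] never increases the functional, it restricts to each sublevel set with c <= b. The cases
    c = a and c = b are the two homotopies, with time reversed because they must end at the
    identity; the maps are the inclusion and H(1, .). *)
Lemma sublevels_homotopy_equivalent : homotopy_equivalent R Ma Mb.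
Proof.
have [H [Hc Hin H0 H1]] := deformation.
have sub : Ma `<=` Mb by move=> x [Mx xa]; split => //; exact: le_trans ab.
have rev : continuous (fun p : R * 'rV[R]_n => (1 - p.1, p.2)).
  move=> p; apply: (@continuous_pair _ _ _ (fun q : R * 'rV[R]_n => 1 - q.1) snd).
    by apply: continuousB; [exact: cst_continuous|exact: cvg_fst].
  exact: cvg_snd.
have retract c : c <= b -> let Mc := [set x | M x /\ dot nu x <= c] in
    homotopic R Mc Mc (fun x => H (1, x)) id.
  move=> cb Mc; exists (fun p => H (1 - p.1, p.2)).
  have s1 (s : R) : s \in `[0, 1] -> 0 <= 1 - s <= 1 by rewrite in_itv /=; lra.
  have McMb : Mc `<=` Mb by move=> x [Mx xc]; split => //; exact: le_trans cb.
  split.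
  + apply: (within_comp (f := fun p : R * 'rV[R]_n => (1 - p.1, p.2))) Hc.
      exact: continuous_subspaceT rev.
    by move=> [s x] [/= /s1 s01 /McMb Mbx]; split => //=; rewrite in_itv.
  + move=> [s x] [/= /s1 s01 [Mx xc]].
    by have [? Hx] := Hin _ _ s01 Mx; split => //; exact: le_trans xc.
  + by move=> x _ /=; rewrite subr0.
  + by move=> x [Mx _] /=; rewrite subrr H0.
exists id, (fun x => H (1, x)); split.
- split; first by move=> x /sub.
  by apply: continuous_subspaceT => x; exact: cvg_id.
- split; first by move=> x /H1.
  apply: (within_comp (f := fun x => (1 : R, x))) Hc; last first.
    by move=> x Mbx; split => //=; rewrite in_itv /= ler01 lexx.
  apply: continuous_subspaceT => x.
  by apply: continuous_pair; [exact: cst_continuous|exact: cvg_id].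
- exact: (retract a ab).
- exact: (retract b (lexx b)).
Qed.

End Deformation.

(** * Calculus *)

Section Calculus.
Variable R : realType.

Lemma is_derive_line n m (g : 'rV[R]_n -> 'rV[R]_m) (x v : 'rV[R]_n) nu (t : R) :
  derivable g (x + t *: v) v ->
  is_derive t (1 : R) (fun s => dot nu (g (x + s *: v)) : R)
    (dot nu ('D_v g (x + t *: v))).
Proof.
move=> dg.
have quot : (fun h : R => h^-1 *: (((fun s => dot nu (g (x + s *: v)) : R) \o shift t)
    (h *: 1) - dot nu (g (x + t *: v)))) =
  dot nu \o (fun h : R => h^-1 *: ((g \o shift (x + t *: v)) (h *: v) - g (x + t *: v))).
  apply/funext => h /=; rewrite -dotBr dotZr; congr (_ * dot nu (g _ - _)).
  by rewrite [h *: 1]mulr1 scalerDl addrCA.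
have cv : (fun h : R => h^-1 *: (((fun s => dot nu (g (x + s *: v)) : R) \o shift t)
    (h *: 1) - dot nu (g (x + t *: v)))) @ 0^' --> dot nu ('D_v g (x + t *: v)).
  rewrite quot; apply: continuous_cvg; first exact: dot_continuous.
  exact: dg.
by split; [exact: cvgP cv|exact: cvg_lim cv].
Qed.

Lemma derive_coord n m (g : 'rV[R]_n -> 'rV[R]_m) (x v : 'rV[R]_n) :
  differentiable g x -> 'D_v g x = \sum_j v 0 j *: 'D_(delta_mx 0 j) g x.
Proof.
move=> dg; rewrite deriveE// {1}(row_sum_delta v) linear_sum.
by apply: eq_bigr => j _; rewrite linearZ deriveE.
Qed.

(** Equality in the mean value theorem fails for vector-valued maps; pairing with [nu] gives a
    scalar function on the segment. *)
Lemma mean_value n m (g : 'rV[R]_n -> 'rV[R]_m) (x y : 'rV[R]_n) nu :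
  (forall t : R, 0 <= t <= 1 -> differentiable g (x + t *: (y - x))) ->
  exists2 t : R, 0 <= t <= 1 & dot nu (g y - g x) =
    \sum_j (y - x) 0 j * dot nu ('D_(delta_mx 0 j) g (x + t *: (y - x))).
Proof.
move=> dg.
pose k s : R := dot nu (g (x + s *: (y - x))).
have dk (t : R) : 0 <= t <= 1 ->
    is_derive t (1 : R) k (dot nu ('D_(y - x) g (x + t *: (y - x)))).
  by move=> /dg dgt; apply: is_derive_line; exact: diff_derivable.
have [| |t] := @MVT_segment R k (fun t => dot nu ('D_(y - x) g (x + t *: (y - x)))) 0 1 ler01.
- by move=> t; rewrite in_itv /= => /andP[t0 t1]; apply: dk; rewrite !ltW.
- apply: derivable_within_continuous => t; rewrite in_itv /= => t01.
  by have [] := dk _ t01.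
rewrite in_itv /= => t01; rewrite subr0 mulr1 /k scale1r scale0r addr0 [x + (y - x)]addrC subrK.
rewrite dotBr => ->; exists t => //.
rewrite derive_coord; last exact: dg.
apply: etrans (dot_sumr _ _ _ _) _; apply: eq_bigr => j _; exact: dotZr.
Qed.

Lemma ball_segment n (p x y : 'rV[R]_n) (r t : R) : `|x - p| < r -> `|y - p| < r ->
  0 <= t <= 1 -> `|x + t *: (y - x) - p| < r.
Proof.
move=> xr yr /andP[t0 t1].
have -> : x + t *: (y - x) - p = (1 - t) *: (x - p) + t *: (y - p).
  by apply/rowP => k; rewrite !mxE; ring.
apply: (le_lt_trans (ler_normD _ _)); rewrite !normrZ !ger0_norm ?subr_ge0//.
have mlt : Num.max `|x - p| `|y - p| < r by rewrite gt_max xr yr.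
have xm : `|x - p| <= Num.max `|x - p| `|y - p| by rewrite le_max lexx.
have ym : `|y - p| <= Num.max `|x - p| `|y - p| by rewrite le_max lexx orbT.
apply: le_lt_trans mlt; move: (Num.max _ _) xm ym => e xm ym.
have t'0 : 0 <= 1 - t by rewrite subr_ge0.
have := ler_wpM2l t0 ym; have := ler_wpM2l t'0 xm; lra.
Qed.

Lemma local_lipschitz n m (U : set 'rV[R]_n) (g : 'rV[R]_n -> 'rV[R]_m) p :
  open U -> U p -> Ck_on 1 U g -> exists r L : R, [/\ 0 < r, 0 <= L,
    forall x, `|x - p| < r -> U x &
    forall x y, `|x - p| < r -> `|y - p| < r -> `|g x - g y| <= L * `|x - y|].
Proof.
move=> oU Up [dg cg].
pose S x : R := \sum_(j < n) `|'D_(delta_mx 0 j) g x|.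
have cs : {for p, continuous S}.
  apply: continuous_at_sum => j.
  apply: (@continuous_comp _ _ _ (fun x => 'D_(delta_mx 0 j) g x) (fun x => `|x|)).
    exact: cg.
  exact: norm_continuous.
have [r1 r10 Hr1] := (continuous_atP _ _).1 cs _ ltr01.
have /nbhs_ballP[r2 /= r20 Hr2] : nbhs p U by exact: open_nbhs_nbhs.
have S0 x : 0 <= S x by apply: sumr_ge0 => j _.
pose L := S p + 1.
exists (Num.min r1 r2), L.
have rU x : `|x - p| < Num.min r1 r2 -> U x.
  by rewrite lt_min => /andP[_ xp]; apply: Hr2; rewrite -ball_normE /= distrC.
split=> //; [by rewrite lt_min r10|by rewrite addr_ge0|].
move=> x y xp yp; apply: norm_le_coord => [|i]; first by rewrite mulr_ge0// addr_ge0.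
have zp (t : R) : 0 <= t <= 1 -> `|x + t *: (y - x) - p| < Num.min r1 r2.
  exact: ball_segment.
have [|t t01] := @mean_value _ _ g x y (delta_mx 0 i) => [t /zp/rU|]; first exact: dg.
rewrite dotC dot_delta => e.
have -> : (g x - g y) 0 i = - (g y - g x) 0 i by rewrite !mxE opprB.
rewrite normrN e (le_trans (ler_norm_sum _ _ _))//.
have : S (x + t *: (y - x)) <= L.
  have := zp _ t01; rewrite lt_min => /andP[+ _]; rewrite distrC => /Hr1.
  by rewrite ltr_norml => /andP[/ltW + _]; rewrite lerNl opprB lerBlDl.
move=> SL; rewrite -(distrC y x) (le_trans _ (ler_wpM2r (normr_ge0 _) SL))//.
rewrite mulr_suml; apply: ler_sum => j _.
rewrite dotC dot_delta normrM mulrC; apply: ler_pM => //; exact: coord_le_norm.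
Qed.

End Calculus.

(** * Charts *)

Lemma fin_common (R : realType) n (P : 'I_n -> R -> R -> Prop) :
  (forall j r r' L L', 0 < r' <= r -> L <= L' -> P j r L -> P j r' L') ->
  (forall j, exists r L : R, [/\ 0 < r, 0 <= L & P j r L]) ->
  exists r L : R, [/\ 0 < r, 0 <= L & forall j, P j r L].
Proof.
move=> mono /fin_all_exists[r] /fin_all_exists[L H].
have r0 : 0 < \big[Num.min/1]_j r j.
  by apply: lt_bigmin => [|j _]//; have [] := H j.
exists (\big[Num.min/1]_j r j), (\sum_j L j); split => //.
  by apply: sumr_ge0 => j _; have [] := H j.
move=> j; have [_ _] := H j; apply: mono.
  by rewrite r0 bigmin_le_cond.
by rewrite (bigD1 j)//= lerDl; apply: sumr_ge0 => k _; have [] := H k.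
Qed.

Lemma linear_coef_eq0 (R : realType) (m c e : R) : 0 < e ->
  (forall t : R, `|t| < e -> 0 <= t * m + c * t ^+ 2) -> m = 0.
Proof.
move=> e0 H; apply/eqP; rewrite -normr_le0 leNgt; apply/negP => m0.
pose s := Num.min (e / 2) (`|m| / (2 * (`|c| + 1))).
have c1 : 0 < `|c| + 1 by rewrite ltr_wpDl.
have s0 : 0 < s by rewrite lt_min !divr_gt0// mulr_gt0.
have se : s < e by rewrite (@le_lt_trans _ _ (e / 2)) ?ge_min ?lexx//; lra.
have sm : s * (2 * (`|c| + 1)) <= `|m|.
  by rewrite -ler_pdivlMr ?mulr_gt0// ge_min lexx orbT.
(* This sign makes the linear term - s |m|, and s is too small for the quadratic term to compensate
   it. *)
have := H (- Num.sg m * s).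
rewrite normrM normrN normr_sg (gtr0_norm s0) exprMn sqrrN.
have mN0 : m != 0 by rewrite -normr_gt0.
rewrite mN0 mul1r => /(_ se); rewrite sqr_sg mN0 mul1r.
have -> : - Num.sg m * s * m = - (s * `|m|) by rewrite normrEsg; ring.
have := ler_wpM2r (sqr_ge0 s) (ler_norm c); have := ler_wpM2l (ltW s0) sm.
by have := mulr_gt0 s0 m0; have := mulr_ge0 (normr_ge0 c) (sqr_ge0 s);
  have := exprn_gt0 2 s0; lra.
Qed.

Section Chart.
Variables (R : realType) (n d : nat) (M : set 'rV[R]_n).
Hypothesis sM : submanifold d M.

(* In a chart phi with inverse psi, T x j is the j-th partial derivative of psi
   at phi x; for j < d these vectors span the tangent space of M at x. *)
Lemma chart_estimates p : M p ->
  exists (r L : R) (phi : 'rV[R]_n -> 'rV[R]_n) (T : 'rV[R]_n -> 'I_n -> 'rV[R]_n),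
  [/\ 0 < r /\ 0 <= L,
    forall x y, `|x - p| < r -> `|y - p| < r ->
      [/\ `|phi x - phi y| <= L * `|x - y|, `|x - y| <= L * `|phi x - phi y|,
          forall j, `|T x j - T y j| <= L * `|x - y|
        & forall nu, `|dot nu (y - x) - \sum_j (phi y - phi x) 0 j * dot nu (T x j)|
          <= L * `|nu| * `|y - x| ^+ 2],
    forall x, `|x - p| < r -> M x -> forall i : 'I_n, (d <= i)%N -> phi x 0 i = 0
  & forall x nu, `|x - p| < r -> prox_normal M nu x ->
      forall j : 'I_n, (j < d)%N -> dot nu (T x j) = 0].
Proof.
move=> Mp; have [_ /(_ p Mp)] := sM.
move=> [U [W [phi [psi [[oU Up] oW [sphi spsi] [UW WU phiK psiK] MU]]]]].
have [r1 [L1 [r10 L10 r1U lip1]]] := local_lipschitz oU Up (sphi 1%N).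
have Wp := UW _ Up.
have [r2 [L2 [r20 L20 r2W lip2]]] := local_lipschitz oW Wp (spsi 1%N).
(* One more derivative: the partial derivatives of [psi] are themselves C^1, hence Lipschitz near
   [phi p]. *)
have [r3 [L3 [r30 L30 lip3]]] : exists r L : R, [/\ 0 < r, 0 <= L &
    forall (j : 'I_n) u w, `|u - phi p| < r -> `|w - phi p| < r ->
    `|'D_(delta_mx 0 j) psi u - 'D_(delta_mx 0 j) psi w| <= L * `|u - w|].
  apply: fin_common => [j r r' L L' /andP[_ rr'] LL' H u w ur wr|j].
    apply: (le_trans (H _ _ (lt_le_trans ur rr') (lt_le_trans wr rr'))).
    by rewrite ler_wpM2r.
  have [_ /(_ (delta_mx 0 j)) c1] := spsi 2%N.
  by have [r [L [? ? _ ?]]] := local_lipschitz oW Wp c1; exists r, L.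
pose r4 := Num.min r2 r3; have r40 : 0 < r4 by rewrite lt_min r20.
have L11 : 0 < L1 + 1 by rewrite ltr_wpDl.
pose r := Num.min r1 (r4 / (L1 + 1)).
have r0 : 0 < r by rewrite lt_min r10 divr_gt0.
have rU x : `|x - p| < r -> U x.
  by rewrite lt_min => /andP[/r1U].
have rphi x : `|x - p| < r -> `|phi x - phi p| < r4.
  rewrite lt_min => /andP[xr1 xr4].
  have pr1 : `|p - p| < r1 by rewrite subrr normr0.
  apply: (le_lt_trans (lip1 _ _ xr1 pr1)).
  rewrite ltr_pdivlMr// in xr4; apply: le_lt_trans xr4.
  by rewrite mulrC ler_wpM2l// lerDl.
have K x : `|x - p| < r -> psi (phi x) = x by move=> /rU Ux; apply: phiK; rewrite inE.
pose T x j := 'D_(delta_mx 0 j) psi (phi x).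
pose N : R := n%:R; have N0 : 0 <= N by [].
(* Taylor remainder: n summands, each at most L1 |y - x| times n |nu| L3 L1 |y - x|, the cost of
   replacing a derivative at an intermediate point by [T x j]. *)
pose L4 := N * N * L3 * L1 ^+ 2.
have L40 : 0 <= L4 by rewrite !mulr_ge0 ?sqr_ge0.
pose L := L1 + L2 + L3 * L1 + L4.
have L3L1 : 0 <= L3 * L1 by rewrite mulr_ge0.
have taylor x y nu : `|x - p| < r -> `|y - p| < r ->
    `|dot nu (y - x) - \sum_j (phi y - phi x) 0 j * dot nu (T x j)|
      <= L4 * `|nu| * `|y - x| ^+ 2.
  move=> xr yr; have xr4 := rphi _ xr; have yr4 := rphi _ yr.
  have zp (t : R) : 0 <= t <= 1 -> `|phi x + t *: (phi y - phi x) - phi p| < r4.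
    exact: ball_segment.
  have [|t t01] := @mean_value _ _ _ psi (phi x) (phi y) nu.
    move=> t /zp; rewrite lt_min => /andP[/r2W Wz _].
    by have [+ _] := spsi 1%N; apply.
  rewrite !K// => ->; rewrite -sumrB (le_trans (ler_norm_sum _ _ _))//.
  have phixy : `|phi y - phi x| <= L1 * `|y - x|.
    by apply: lip1; [move: yr|move: xr]; rewrite lt_min => /andP[].
  have -> : L4 * `|nu| * `|y - x| ^+ 2 =
      \sum_(j < n) (N * L3 * `|nu| * (L1 * `|y - x|) ^+ 2).
    by rewrite sumr_const card_ord -mulr_natl /L4 -/N; ring.
  apply: ler_sum => j _; rewrite -mulrBr normrM -dotBr.
  have zr3 : `|phi x + t *: (phi y - phi x) - phi p| < r3.
    by have := zp _ t01; rewrite lt_min => /andP[].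
  have xr3 : `|phi x - phi p| < r3 by move: xr4; rewrite lt_min => /andP[].
  have := lip3 j _ _ zr3 xr3; rewrite addrAC subrr add0r normrZ => Dz.
  have {}Dz : `|'D_(delta_mx 0 j) psi (phi x + t *: (phi y - phi x)) - T x j| <=
      L3 * (L1 * `|y - x|).
    apply: (le_trans Dz); rewrite ler_wpM2l// (le_trans _ phixy)//.
    by case/andP: t01 => t0 t1; rewrite ger0_norm// ler_piMl.
  have := dot_le_norm nu ('D_(delta_mx 0 j) psi (phi x + t *: (phi y - phi x)) - T x j).
  rewrite -/N => Hdot.
  have N1 : 0 <= N * `|nu| by rewrite mulr_ge0.
  have := le_trans Hdot (ler_wpM2l N1 Dz) => {}Hdot.
  have := coord_le_norm (phi y - phi x) j => /le_trans/(_ phixy) cj.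
  apply: (le_trans (ler_pM _ _ cj Hdot)) => //.
  by rewrite le_eqVlt; apply/orP; left; apply/eqP; ring.
have lipphi x y : `|x - p| < r -> `|y - p| < r -> `|phi x - phi y| <= L1 * `|x - y|.
  by move=> xr yr; apply: lip1; [move: xr|move: yr]; rewrite lt_min => /andP[].
have LW C (t : R) : 0 <= t -> C <= L -> C * t <= L * t by move=> *; rewrite ler_wpM2r.
exists r, L, phi, T; split.
- by split=> //; rewrite /L; lra.
- move=> x y xr yr; split.
  + by apply: (le_trans (lipphi _ _ xr yr)); rewrite LW// /L; lra.
  + rewrite -{1}(K _ xr) -{1}(K _ yr).
    have := rphi _ xr; have := rphi _ yr; rewrite !lt_min => /andP[yr2 _] /andP[xr2 _].
    by apply: (le_trans (lip2 _ _ xr2 yr2)); rewrite LW// /L; lra.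
  + move=> j; have := rphi _ xr; have := rphi _ yr.
    rewrite !lt_min => /andP[_ yr3] /andP[_ xr3].
    apply: (le_trans (lip3 j _ _ xr3 yr3)).
    apply: (@le_trans _ _ (L3 * L1 * `|x - y|)); last by rewrite LW// /L; lra.
    by rewrite -mulrA ler_wpM2l// lipphi.
  + move=> nu; apply: (le_trans (taylor _ _ nu xr yr)).
    apply: ler_wpM2r; first exact: sqr_ge0.
    by apply: ler_wpM2r => //; rewrite /L; lra.
- by move=> x /rU Ux Mx; exact: (MU _ Ux).1.
move=> x nu xr [Mx [C HC]] j jd.
have Ux := rU _ xr; have Wx := UW _ Ux.
have /nbhs_ballP[s1 /= s10 Hs1] : nbhs (phi x) W by exact: open_nbhs_nbhs.
have xr4 := rphi _ xr.
pose s2 := r4 - `|phi x - phi p|; have s20 : 0 < s2 by rewrite subr_gt0.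
have L21 : 0 < L2 + 1 by rewrite ltr_wpDl.
pose s3 := (r - `|x - p|) / (L2 + 1).
have s30 : 0 < s3 by rewrite divr_gt0// subr_gt0.
pose s := Num.min s1 (Num.min s2 s3).
have s0 : 0 < s by rewrite !lt_min s10 s20.
pose c := (L4 * `|nu| + `|C| * N) * L2 ^+ 2.
apply: (@linear_coef_eq0 _ _ c s s0) => t; rewrite !lt_min => /and3P[ts1 ts2 ts3].
(* As j < d, moving along the j-th axis keeps the coordinates from d on equal to 0, so [psi w] is in
   M. The proximal inequality there becomes 0 <= t (nu . T x j) + c t^2, for t of either sign. *)
pose w := phi x + t *: delta_mx 0 j.
have nd : `|t *: delta_mx 0 j : 'rV[R]_n| <= `|t|.
  rewrite normrZ ler_piMr//; apply: norm_le_coord => // i.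
  by rewrite mxE eqxx /=; case: (i == j); rewrite ?normr1 ?normr0.
have wW : W w.
  apply: Hs1; rewrite -ball_normE /= /w opprD addrA subrr sub0r normrN.
  exact: le_lt_trans nd _.
have wr4 : `|w - phi p| < r4.
  rewrite /w addrAC; apply: (le_lt_trans (ler_normD _ _)).
  by move: ts2; rewrite /s2 => ts2; lra.
have psiw : `|psi w - x| <= L2 * `|t|.
  rewrite -{1}(K _ xr); move: wr4 xr4; rewrite !lt_min => /andP[wr2 _] /andP[xr2 _].
  apply: (le_trans (lip2 _ _ wr2 xr2)); rewrite ler_wpM2l// /w addrAC subrr add0r.
  exact: nd.
have psir : `|psi w - p| < r.
  have -> : psi w - p = (psi w - x) + (x - p) by rewrite addrA subrK.
  rewrite (le_lt_trans (ler_normD _ _))//.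
  rewrite /s3 ltr_pdivlMr// in ts3; have := normr_ge0 t; lra.
have phipsi : phi (psi w) = w by apply: psiK; rewrite inE.
have Mw : M (psi w).
  apply/(MU _ (rU _ psir)) => i di; rewrite phipsi !mxE /=.
  have := (MU _ Ux).1 Mx i di => ->.
  case: eqP => [ij|_]; last by rewrite mulr0 addr0.
  by move: jd; rewrite -ij ltnNge di.
have := HC _ Mw; have := taylor _ _ nu xr psir; rewrite phipsi.
have -> : \sum_j0 (w - phi x) 0 j0 * dot nu (T x j0) = t * dot nu (T x j).
  rewrite (bigD1 j)//= big1 ?addr0 => [|i /negPf ij].
    by rewrite /w !mxE !eqxx mulr1 addrAC subrr add0r.
  by rewrite /w !mxE /= ij mulr0 addr0 subrr mul0r.
have := dot_le_norm (psi w - x) (psi w - x); rewrite -/N.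
set D := dot (psi w - x) _; set e := `|psi w - x| in psiw *.
move=> HD; have D0 : 0 <= D by exact: dot_ge0.
rewrite (ger0_norm D0) in HD.
have e2 : e ^+ 2 <= L2 ^+ 2 * t ^+ 2.
  rewrite -(real_normK (num_real t)) -exprMn; apply: lerXn2r => //.
    exact: normr_ge0.
  by rewrite nnegrE mulr_ge0.
have t1 : L4 * `|nu| * e ^+ 2 <= L4 * `|nu| * (L2 ^+ 2 * t ^+ 2).
  by rewrite ler_wpM2l// mulr_ge0.
have t2 : C * D <= `|C| * N * (L2 ^+ 2 * t ^+ 2).
  apply: (@le_trans _ _ (`|C| * D)); first by rewrite ler_wpM2r// ler_norm.
  rewrite -mulrA ler_wpM2l// (le_trans HD)// -mulrA -expr2 ler_wpM2l//.
rewrite ler_norml => /andP[_ Htay] Hprox; rewrite /c; lra.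
Qed.

End Chart.

(** * Thin sets *)

(** Completeness of the space of row vectors, for [Baire]. *)
HB.instance Definition _ (R : realType) m n := Complete.on 'M[R]_(m, n).

Section Thin.
Variable R : realType.

(** Positive reach near p. If a and b are both nearest to y, then a - y and b - y are normals, and
    chords are tangent up to a quadratic error; adding the two estimates gives |b - a|^2 <= 2 L N |y
    - p| |b - a|^2, so a = b once y is close to p. *)
Lemma unique_near n d (M : set 'rV[R]_n) p : submanifold d M -> M p ->
  exists2 r : R, 0 < r & forall y, `|y - p| < r -> uniquely_nearest M y.
Proof.
move=> sM Mp.
have [r [L [phi [T [[r0 L0] est phi0 Tperp]]]]] := chart_estimates sM Mp.
pose N : R := n%:R + 1; have N1 : 1 <= N by rewrite /N lerDr.
pose c := 2 * (L + 1) * (N + 1); have c0 : 0 < c by rewrite !mulr_gt0//; lra.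
(* The first bound keeps the nearest points, which lie within (N + 1) |y - p| of p, in the chart;
   the second makes 2 L N |y - p| less than 1. *)
exists (Num.min (r / (2 * (N + 1))) c^-1).
  by rewrite lt_min invr_gt0 c0 divr_gt0//; lra.
move=> y; rewrite lt_min => /andP[yr yc].
set t := `|y - p| in yr yc; have t0 : 0 <= t by exact: normr_ge0.
rewrite ltr_pdivlMr in yr; last lra.
rewrite -[c^-1]mul1r ltr_pdivlMr// in yc.
have close a : nearest M y a -> `|a - y| <= N * t /\ `|a - p| < r.
  move=> [_ /(_ _ Mp)] /(le_trans (norm_le_dot _)) H.
  have {}H : `|a - y| <= N * t.
    rewrite -ler_sqr ?nnegrE ?mulr_ge0//; last lra.
    apply: (le_trans H); apply: (le_trans (ler_norm _)).
    apply: (le_trans (dot_le_norm _ _)); rewrite distrC -/t exprMn -mulrA -expr2.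
    have n0 : 0 <= n%:R :> R by [].
    apply: ler_wpM2r; first exact: sqr_ge0.
    by rewrite /N; move: n0; move: (n%:R : R) => m m0; have := mulr_ge0 m0 m0; lra.
  split => //; have -> : a - p = (a - y) + (y - p) by rewrite addrA subrK.
  apply: (le_lt_trans (ler_normD _ _)); rewrite -/t; lra.
have perp a b : nearest M y a -> nearest M y b ->
    `|dot (a - y) (b - a)| <= L * (N * t) * `|b - a| ^+ 2.
  move=> na nb; have [ay ap] := close _ na; have [by' bp] := close _ nb.
  have pa : prox_normal M (a - y) a.
    have := @nearest_prox_normal _ _ M y a 0 1 ltr01.
    by rewrite scaler0 subr0 add0r invr1 scale1r; apply.
  have [_ _ _ /(_ (a - y))] := est _ _ ap bp.
  rewrite big1 => [|j _]; last first.
    have [jd|dj] := ltnP j d; first by rewrite (Tperp _ _ ap pa)// mulr0.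
    have [Ma _] := na; have [Mb _] := nb.
    by rewrite !mxE (phi0 _ ap Ma _ dj) (phi0 _ bp Mb _ dj) subrr mul0r.
  rewrite subr0 => /le_trans; apply; apply: ler_wpM2r; first exact: sqr_ge0.
  exact: ler_wpM2l.
move=> a b na nb.
have Hab := perp _ _ na nb; have := perp _ _ nb na; rewrite (distrC a b) => Hba.
have e : dot (b - a) (b - a) = - dot (a - y) (b - a) - dot (b - y) (a - b).
  by rewrite !(dotBl, dotBr) (dotC a b) (dotC y); ring.
have := norm_le_dot (b - a).
move: Hab Hba; rewrite e !ler_norml; set D1 := dot _ _; set D2 := dot _ _.
set w := `|b - a| ^+ 2 => /andP[H1 _] /andP[H2 _] H3.
have w0 : 0 <= w by exact: sqr_ge0.
have Lc : 2 * (L * (N * t)) <= t * c.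
  by rewrite /c; have := mulr_ge0 L0 t0; have := mulr_ge0 (le_trans ler01 N1) t0; lra.
have {}w0 : w = 0.
  by apply/eqP; rewrite eq_le w0 andbT leNgt; apply/negP => w1;
    have := ler_wpM2r (ltW w1) Lc; have := ltr_pM2r w1 (t * c) 1; rewrite yc; lra.
by apply/eqP; rewrite eq_sym -subr_eq0 -normr_eq0 -sqrf_eq0 -/w w0.
Qed.

(** Jordan content zero, by equal cubes: a sup-norm ball of radius r has volume (2 r)^m. Finiteness
    of the covers makes the closure nowhere dense, as Baire's theorem demands, while countable
    unions remain Lebesgue null. *)
Definition thin m (E : set 'rV[R]_m) := forall e : R, 0 < e ->
  exists (s : seq 'rV[R]_m) (r : R), [/\ 0 < r,
    forall x, E x -> exists2 c, c \in s & `|x - c| <= r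
    & (size s)%:R * (2 * r) ^+ m < e].

Lemma thinS m (E F : set 'rV[R]_m) : E `<=` F -> thin F -> thin E.
Proof.
by move=> EF tF e /tF[s [r [r0 Fs sr]]]; exists s, r; split => // x /EF /Fs.
Qed.

Lemma thin0 m : thin (@set0 'rV[R]_m).
Proof. by move=> e e0; exists [::], 1; split => //; rewrite mul0r. Qed.

(* Cutting the parameters into N^k cells covers the image by N^k cubes of side
   O(1/N), hence of total volume O(1/N). *)
Lemma thin_lipschitz k I (A : set I) (f : I -> 'rV[R]_k.+1) (z : I -> 'rV[R]_k)
    (K L : R) : (forall i, A i -> `|z i| <= K) ->
  (forall i j, A i -> A j -> `|f i - f j| <= L * `|z i - z j|) -> thin (f @` A).
Proof.
move=> zK fL e e0.
pose K' := `|K| + 1; have K'0 : 0 < K' by rewrite ltr_wpDl.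
pose L' := `|L| + 1; have L'0 : 0 < L' by rewrite ltr_wpDl.
pose C := (4 * L' * K') ^+ k.+1; have C0 : 0 < C by rewrite exprn_gt0// !mulr_gt0.
(* The total volume will be N^k C / N^(k+1) = C / N. *)
pose N := (Num.bound (C / e)).+1; have N0 : 0 < N%:R :> R by rewrite ltr0Sn.
have CN : C < e * N%:R.
  rewrite mulrC -ltr_pdivrMr//; apply: (lt_trans (archi_boundP _)).
    by rewrite divr_ge0 ?ltW.
  by rewrite ltr_nat.
pose w i j : R := (z i 0 j + K') * N%:R / (2 * K').
have wN i j : A i -> 0 <= w i j < N%:R.
  move=> Ai; have := le_trans (coord_le_norm (z i) j) (zK _ Ai).
  rewrite ler_norml => /andP[z1 z2].
  have := ler_norm K; have := ler_norm (- K); rewrite normrN => K1 K2.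
  rewrite divr_ge0 ?mulr_ge0 ?(ltW N0) ?(ltW K'0)//=; last by rewrite /K'; lra.
  rewrite ltr_pdivrMr ?mulr_gt0// mulrC ltr_pM2l// /K'; lra.
pose cell i : {ffun 'I_k -> 'I_N} := [ffun j => inord (Num.truncn (w i j))].
(* A nonempty cell is represented by the image of one of its own parameters, an empty one by 0. *)
pose ctr (c : {ffun 'I_k -> 'I_N}) : 'rV[R]_k.+1 :=
  if pselect (exists2 i, A i & cell i = c) is left H then f (projT1 (cid2 H)) else 0.
exists [seq ctr c | c <- enum {: {ffun 'I_k -> 'I_N}}], (L' * (2 * K' / N%:R)).
split; first by rewrite mulr_gt0 ?divr_gt0 ?mulr_gt0.
- move=> _ [i Ai <-]; exists (ctr (cell i)); first by rewrite map_f// mem_enum.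
  rewrite /ctr; case: pselect => [H|[]]; last by exists i.
  case: cid2 => i' Ai' /= ii'.
  apply: (le_trans (fL _ _ Ai Ai')).
  apply: (@le_trans _ _ (L' * `|z i - z i'|)).
    by rewrite ler_wpM2r// /L' (le_trans (ler_norm L))// lerDl.
  rewrite ler_wpM2l ?(ltW L'0)//; apply: norm_le_coord => [|j].
    by apply: divr_ge0; [apply: mulr_ge0 => //|]; exact: ltW.
  have := congr1 (fun c : {ffun 'I_k -> 'I_N} => nat_of_ord (c j)) ii'; rewrite !ffunE.
  have [w0 wlt] := andP (wN _ j Ai); have [w'0 w'lt] := andP (wN _ j Ai').
  have := truncn_itv w0; have := truncn_itv w'0.
  have tN (v : R) : 0 <= v < N%:R -> (Num.truncn v < N)%N.
    move=> /andP[v0 vN]; have /andP[tv _] := truncn_itv v0.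
    by rewrite -(ltr_nat R); exact: le_lt_trans tv vN.
  rewrite !inordK; try by apply: tN; apply: wN.
  move=> /andP[a1 a2] /andP[b1 b2] ab; rewrite ab in a1 a2.
  rewrite -natr1 in a2 b2.
  have : `|w i j - w i' j| <= 1 by rewrite ler_norml; apply/andP; split; lra.
  have -> : w i j - w i' j = (z i - z i') 0 j * (N%:R / (2 * K')).
    by rewrite /w !mxE; ring.
  rewrite normrM (gtr0_norm (divr_gt0 N0 (mulr_gt0 _ K'0)))//.
  by rewrite -ler_pdivlMr ?divr_gt0 ?mulr_gt0// mul1r invf_div.
- rewrite size_map -cardE card_ffun !card_ord natrX.
  have -> : N%:R ^+ k * (2 * (L' * (2 * K' / N%:R))) ^+ k.+1 = C / N%:R.
    have -> : 2 * (L' * (2 * K' / N%:R)) = (4 * L' * K') / N%:R by ring.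
    rewrite expr_div_n -/C exprS.
    have : N%:R ^+ k != 0 :> R by rewrite expf_neq0// gt_eqF.
    move: (N%:R ^+ k) => a a0; field; rewrite a0 gt_eqF//.
  by rewrite ltr_pdivrMr.
Qed.

(** Counting replaces measure. If the closure contained the ball, it would contain a grid of N^m
    points with spacing 5 r, each less than 9 r / 4 from a centre; as 9 r / 2 < 5 r, no centre
    serves two of them, and N^m <= [size s]. But N r > s0 / 10, against the volume of the cover. *)
Lemma thin_closure_no_ball m (E : set 'rV[R]_m) x0 (s0 : R) : thin E -> 0 < s0 ->
  exists2 y, `|y - x0| < s0 & ~ closure E y.
Proof.
move=> tE s00; apply: contrapT => /forall2NP H.
have {}H y : `|y - x0| < s0 -> closure E y by move=> yx; have [//|/contrapT] := H y.
have [|s [r [r0 Es sr]]] := tE ((s0 / 10) ^+ m); first by rewrite exprn_gt0// divr_gt0.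
pose N := (Num.truncn (s0 / (10 * r))).+1.
have q0 : 0 <= s0 / (10 * r) by rewrite divr_ge0 ?mulr_ge0 ?ltW.
have /andP[N1 N2] := truncn_itv q0; rewrite -/N in N2.
pose pt (g : {ffun 'I_m -> 'I_N}) : 'rV[R]_m := \row_j (x0 0 j + 5 * r * (g j)%:R).
have ptE g : closure E (pt g).
  apply: H; apply: norm_lt_coord => // j; rewrite !mxE addrAC subrr add0r.
  rewrite ger0_norm ?mulr_ge0 ?(ltW r0)//.
  have gN : (g j)%:R <= s0 / (10 * r) :> R.
    by apply: le_trans N1; rewrite ler_nat -ltnS.
  rewrite ler_pdivlMr ?mulr_gt0// in gN; lra.
have ptc g : exists i : 'I_(size s), `|pt g - tnth (in_tuple s) i| < 2 * r + r / 4.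
  have [y [Ey]] : E `&` ball (pt g) (r / 4) !=set0.
    by apply: ptE; apply: nbhsx_ballx; rewrite divr_gt0.
  rewrite -ball_normE /= => gy; have [c cs yc] := Es _ Ey.
  have ci : (index c s < size s)%N by rewrite index_mem.
  exists (Ordinal ci); rewrite (tnth_nth 0) /= nth_index//.
  have -> : pt g - c = (pt g - y) + (y - c) by rewrite addrA subrK.
  by apply: (le_lt_trans (ler_normD _ _)); lra.
have [F FP] := choice ptc.
have Finj : injective F.
  move=> g g' gg; apply/ffunP => j; apply/val_inj/eqP => /=.
  have := FP g; have := FP g'; rewrite gg; set c := tnth _ _ => H1 H2.
  have : `|(pt g - pt g') 0 j| < 5 * r.
    apply: (le_lt_trans (coord_le_norm _ _)).
    have -> : pt g - pt g' = (pt g - c) - (pt g' - c) by rewrite opprB addrA subrK.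
    by apply: (le_lt_trans (ler_normB _ _)); lra.
  rewrite !mxE opprD addrACA subrr add0r -mulrBr normrM gtr0_norm ?mulr_gt0//.
  rewrite -[ltRHS]mulr1 ltr_pM2l ?mulr_gt0// => gj.
  move: gj; rewrite ltr_norml => /andP[? ?].
  by rewrite eqn_leq; apply/andP; split; rewrite -ltnS -(ltr_nat R) -natr1; lra.
have := leq_card F Finj; rewrite card_ffun !card_ord -(ler_nat R) natrX => cardN.
have : (s0 / 10) ^+ m <= (size s)%:R * (2 * r) ^+ m.
  apply: (@le_trans _ _ (N%:R ^+ m * r ^+ m)); last first.
    apply: ler_pM => //; rewrite ?exprn_ge0 ?(ltW r0)//.
    by apply: lerXn2r; rewrite ?nnegrE ?mulr_ge0 ?(ltW r0)//; lra.
  rewrite -exprMn; apply: lerXn2r; rewrite ?nnegrE ?mulr_ge0 ?divr_ge0 ?(ltW r0) ?(ltW s00)//.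
  by move: N2; rewrite ltr_pdivrMr ?mulr_gt0// => N2; lra.
by move=> /le_lt_trans/(_ sr); rewrite ltxx.
Qed.

Lemma thin_union_no_ball m (E : nat -> set 'rV[R]_m) x0 (s0 : R) :
  (forall j, thin (E j)) -> 0 < s0 -> exists2 y, `|y - x0| < s0 & forall j, ~ E j y.
Proof.
move=> tE s00.
have [] := @Baire R 'rV[R]_m (fun j => ~` closure (E j)) _ (ball x0 s0).
- move=> j; split; first by apply: closed_openC; exact: closed_closure.
  move=> D [y Dy] oD.
  have /nbhs_ballP[e /= e0 eD] : nbhs y D by exact: open_nbhs_nbhs.
  have [z zy Ez] := thin_closure_no_ball y (tE j) e0.
  by exists z; split => //; apply: eD; rewrite -ball_normE /= distrC.
- by exists x0; exact: ballxx.
- exact: ball_open.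
move=> y [yx yE]; exists y; first by move: yx; rewrite -ball_normE /= distrC.
by move=> j Ej; apply: (yE j I); exact: subset_closure.
Qed.

End Thin.

(** * Countable unions and countable covers *)

Section Countable.
Variable R : realType.

Lemma thin_union_null m (E : nat -> set 'rV[R]_m) (A : set 'rV[R]_m) :
  (forall j, thin (E j)) -> A `<=` \bigcup_j E j -> lebesgue_null A.
Proof.
move=> tE AE e e0.
have e2 : 0 < e / 2 by rewrite divr_gt0.
have /choice[s /choice[r H]] j : exists (s : seq 'rV[R]_m) (r : R), [/\ 0 < r,
    forall x, E j x -> exists2 c, c \in s & `|x - c| <= r
    & (size s)%:R * (2 * r) ^+ m < e / 2 / (2 ^ j.+1)%:R].
  by apply: tE; rewrite divr_gt0// ltr0n expn_gt0.
pose P := [set: nat] `*`` (fun j => `I_(size (s j))).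
pose code : nat * nat -> nat := pickle.
pose ctr k : 'rV[R]_m :=
  if (unpickle k : option (nat * nat)) is Some (j, i) then nth 0 (s j) i else 0.
pose rad k : R := if (unpickle k : option (nat * nat)) is Some (j, i) then r j else 0.
(* Cubes are indexed by the codes of the pairs (j, i) with i < size (s j); codes are injective, so
   the sum over them is a double sum. *)
exists (code @` P), (fun k => ctr k - const_mx (rad k)), (fun k => ctr k + const_mx (rad k)).
have rad0 k : 0 <= rad k.
  by rewrite /rad; case: (unpickle k : option (nat * nat)) => [[j i]|//]; have [/ltW] := H j.
split.
- by move=> k _ i; rewrite !mxE; have := rad0 k; lra.
- move=> x /AE[j _ Ejx]; have [r0 /(_ _ Ejx)[c cs xc] _] := H j.
  exists (code (j, index c (s j))).
    by exists (j, index c (s j)) => //; split => //=; rewrite index_mem.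
  move=> i; rewrite !mxE /ctr /rad /code pickleK nth_index//.
  have := le_trans (coord_le_norm (x - c) i) xc; rewrite !mxE ler_norml.
  by move=> /andP[h1 h2]; apply/andP; split; lra.
have -> : (fun k : nat => (\prod_(i < m) ((ctr k + const_mx (rad k)) 0 i -
    (ctr k - const_mx (rad k)) 0 i))%:E) = (fun k => ((2 * rad k) ^+ m)%:E).
  apply/funext => k; rewrite -[in RHS](card_ord m) -prodr_const; congr _%:E.
  by apply: eq_bigr => i _; rewrite !mxE; ring.
rewrite esum_image; last first.
  by move=> p q _ _; exact: (pcan_inj pickleK).
have -> : \esum_(i in P) ((2 * rad (code i)) ^+ m)%:E =
    \esum_(i in P) ((fun j _ => ((2 * r j) ^+ m)%:E) i.1 i.2).
  by apply: eq_esum => -[j i] _; rewrite /rad /code pickleK.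
rewrite -(@esum_esum _ _ _ setT (fun j => `I_(size (s j)))
  (fun j _ => ((2 * r j) ^+ m)%:E)); last first.
  by move=> j i _ _; rewrite lee_fin exprn_ge0// mulr_ge0//; have [/ltW] := H j.
apply: (@le_lt_trans _ _ (e / 2)%:E); last by rewrite lte_fin; lra.
apply: le_trans (epsilon_trick0 predT (ltW e2)).
rewrite nneseries_esum => [|j _]; last first.
  by rewrite lee_fin divr_ge0// ltW.
rewrite set_true; apply: le_esum => j _.
have [r0 _ /ltW Hj] := H j.
have v0 : 0 <= (2 * r j) ^+ m by rewrite exprn_ge0// mulr_ge0// ltW.
rewrite esum_fset => [||i _]; [|exact: finite_II|by rewrite lee_fin].
rewrite -fsbig_ord sumEFin lee_fin sumr_const card_ord -[leLHS]mulr_natl.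
exact: Hj.
Qed.

(* The countable cover consists of balls centred at points with coordinates in
   Z/(k+1) and of radius 1/(k+1). *)
Lemma countable_cover m (X : set 'rV[R]_m) (P : set 'rV[R]_m -> Prop) :
  P set0 -> (forall A B, A `<=` B -> P B -> P A) ->
  (forall x, X x -> exists2 r : R, 0 < r & P [set y | `|y - x| < r]) ->
  exists B : nat -> set 'rV[R]_m, (forall j, P (B j)) /\ X `<=` \bigcup_j B j.
Proof.
move=> P0 PS Ploc.
pose Bq (qk : 'rV[int]_m * nat) : set 'rV[R]_m :=
  [set y | forall i, `|y 0 i - (qk.1 0 i)%:~R / qk.2.+1%:R| <= qk.2.+1%:R^-1].
(* A cube on which [P] fails is replaced by [set0], so that [P] holds for every member. *)
pose B j : set 'rV[R]_m := if unpickle j is Some qk then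
  if pselect (P (Bq qk)) then Bq qk else set0 else set0.
exists B; split.
  by move=> j; rewrite /B; case: unpickle => [qk|//]; case: pselect.
move=> x Xx; have [r r0 Px] := Ploc _ Xx.
pose k := Num.bound (2 / r); have k0 : 0 < k.+1%:R :> R by rewrite ltr0Sn.
have kr : 2 / k.+1%:R < r.
  rewrite ltr_pdivrMr// mulrC -ltr_pdivrMr//.
  apply: (lt_trans (archi_boundP _)); first by rewrite divr_ge0// ltW.
  by rewrite ltr_nat.
pose q : 'rV[int]_m := \row_i Num.floor (x 0 i * k.+1%:R).
have xq : Bq (q, k) x.
  move=> i /=; rewrite mxE.
  have /andP[f1 f2] := floor_itv (x 0 i * k.+1%:R).
  have -> : x 0 i - (Num.floor (x 0 i * k.+1%:R))%:~R / k.+1%:R =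
      (x 0 i * k.+1%:R - (Num.floor (x 0 i * k.+1%:R))%:~R) / k.+1%:R.
    by field; rewrite gt_eqF.
  rewrite normrM [X in _ * X]gtr0_norm ?invr_gt0// ler_piMl ?invr_ge0 ?(ltW k0)//.
  by rewrite ger0_norm ?subr_ge0//; rewrite intrD1 in f2; lra.
have PB : P (Bq (q, k)).
  apply: PS Px => y yq /=; apply: le_lt_trans kr.
  apply: norm_le_coord => [|i]; first by rewrite divr_ge0// ltW.
  have := yq i; have := xq i; rewrite !mxE /=.
  move: (_%:~R / _) => F; rewrite !ler_norml => /andP[h1 h2] /andP[h3 h4].
  by move: (_%:R^-1) h1 h2 h3 h4 => t *; apply/andP; split; lra.
exists (pickle (q, k)) => //; rewrite /B pickleK; by case: pselect.
Qed.

End Countable.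

(** * Dimension count for the conormal bundle *)

Section ConormalImage.
Variables (R : realType) (n d : nat) (M : set 'rV[R]_n).
Hypothesis sM : submanifold d M.

(** With [s] last, |x|^2 becomes the outermost variable of the iterated polynomials, the one in
    which leading coefficients are taken. *)
Definition extend (v : 'rV[R]_n) (s : R) : 'rV[R]_n.+1 :=
  \row_i if unlift ord_max i is Some j then v 0 j else s.

Lemma extend_max v s : extend v s 0 ord_max = s.
Proof. by rewrite mxE unlift_none. Qed.

Lemma extend_lift v s j : extend v s 0 (lift ord_max j) = v 0 j.
Proof. by rewrite mxE liftK. Qed.

Lemma norm_extend_le v s (e : R) : `|v| <= e -> `|s| <= e -> `|extend v s| <= e.
Proof.
move=> ve se; apply: norm_le_coord => [|i]; first exact: le_trans ve.
rewrite mxE; case: unliftP => [j _|_] //.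
by apply: le_trans ve; exact: coord_le_norm.
Qed.

Lemma extendB v w s t : extend v s - extend w t = extend (v - w) (s - t).
Proof. by apply/rowP => i; rewrite !mxE; case: unlift => [j|]; rewrite ?mxE. Qed.

(** The bound [k] keeps the parameters bounded; a countable union over integers k recovers all
    normals. *)
Definition conormal_image (X : set 'rV[R]_n) (k : R) : set 'rV[R]_n.+1 :=
  (fun p : 'rV[R]_n * 'rV[R]_n => extend p.1 (dot p.2 p.2)) @`
  [set p | [/\ X p.2, prox_normal M p.1 p.2 & `|p.1| <= k]].

(* A point of the conormal bundle is given by n numbers: the d coordinates of its
   foot and the n - d components of nu transverse to the tangent space. *)
Lemma conormal_image_locally_thin x : M x -> exists2 r : R, 0 < r &
  forall k : R, 0 <= k -> thin (conormal_image [set y | `|y - x| < r] k).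
Proof.
move=> Mx.
have [r [L [phi [T [[r0 L0] est phi0 Tperp]]]]] := chart_estimates sM Mx.
exists r => // k k0.
pose z (p : 'rV[R]_n * 'rV[R]_n) : 'rV[R]_n :=
  \row_j if (j < d)%N then phi p.2 0 j else dot p.1 (T p.2 j).
pose N : R := n%:R; have N0 : 0 <= N by [].
have xx : `|x - x| < r by rewrite subrr normr0.
pose TT := \sum_j `|T x j|.
pose K := `|phi x| + L * r + N * k * (TT + L * r).
have TT0 : 0 <= TT by apply: sumr_ge0.
pose B := N * (2 * (`|x| + r)).
have B0 : 0 <= B by rewrite !mulr_ge0// addr_ge0// ltW.
pose C1 := 2 * N * L * (1 + N * k * L * L).
have C10 : 0 <= C1.
  rewrite mulr_ge0// ?(mulr_ge0 _ L0)// ?mulr_ge0//.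
  by rewrite addr_ge0// !mulr_ge0.
apply: (@thin_lipschitz _ _ _ _ _ z K (C1 + B * L)).
- move=> [nu y] [/= yr _ nuk]; apply: norm_le_coord => [|j].
    by rewrite /K !addr_ge0// !mulr_ge0// ?addr_ge0// ?mulr_ge0// ltW.
  have [lip _ lipT _] := est _ _ yr xx.
  have Lr : L * `|y - x| <= L * r by rewrite ler_wpM2l// ltW.
  rewrite mxE /=; case: ifP => _.
    have c := le_trans (coord_le_norm (phi y - phi x) j) lip.
    have c' := coord_le_norm (phi x) j.
    have : `|phi y 0 j| <= `|(phi y - phi x) 0 j| + `|phi x 0 j|.
      by rewrite !mxE (le_trans _ (ler_normD _ _))// subrK.
    have : 0 <= N * k * (TT + L * r).
      by rewrite !mulr_ge0// addr_ge0// mulr_ge0// ltW.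
    rewrite /K; lra.
  apply: (le_trans (dot_le_norm _ _)); rewrite -/N.
  have t1 : `|T y j| <= TT + L * r.
    have : `|T y j| <= `|T y j - T x j| + `|T x j|.
      by rewrite (le_trans _ (ler_normD _ _))// subrK.
    have : `|T x j| <= TT by rewrite /TT (bigD1 j)//= lerDl sumr_ge0.
    have := lipT j; lra.
  apply: (@le_trans _ _ (N * k * (TT + L * r))).
    by apply: ler_pM; rewrite ?mulr_ge0// ler_wpM2l.
  by rewrite /K lerDr addr_ge0// mulr_ge0// ltW.
move=> [nu y] [nu' y'] [/= yr py nuk] [/= yr' py' nuk'].
have [My _] := py; have [My' _] := py'.
set D := `|z _ - z _|; have D0 : 0 <= D by exact: normr_ge0.
have zD j : `|(z (nu, y) - z (nu', y')) 0 j| <= D by exact: coord_le_norm.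
(* The coordinates of [phi] that [z] omits vanish on M. *)
have phiD : `|phi y - phi y'| <= D.
  apply: norm_le_coord => // j; have := zD j; rewrite !mxE /=.
  by case: ltnP => // dj; rewrite (phi0 _ yr My _ dj) (phi0 _ yr' My' _ dj) subrr normr0.
have [_ lipy lipT _] := est _ _ yr yr'.
have yD : `|y - y'| <= L * D by rewrite (le_trans lipy)// ler_wpM2l.
set w := nu - nu'.
have wT j : `|dot w (T y j)| <= (1 + N * k * L * L) * D.
  have -> : dot w (T y j) = (dot nu (T y j) - dot nu' (T y' j)) -
      dot nu' (T y j - T y' j) by rewrite dotBl dotBr; ring.
  apply: (le_trans (ler_normB _ _)); rewrite mulrDl mul1r; apply: lerD.
    have [jd|dj] := ltnP j d.
      by rewrite (Tperp _ _ yr py)// (Tperp _ _ yr' py')// subrr normr0.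
    by have := zD j; rewrite !mxE /= ltnNge dj.
  apply: (le_trans (dot_le_norm _ _)); rewrite -/N -!mulrA ler_wpM2l//.
  apply: ler_pM => //; apply: (le_trans (lipT j)); rewrite ler_wpM2l//.
(* The vectors [T y j] span the space, in a quantitative form that inverts no Jacobian: the
   expansion of the displacement t w at y, paired with w itself, bounds t |w|^2 by the products
   [dot w (T y j)] plus a quadratic error. The second bound on [t] lets half of |w| absorb this
   error. *)
have wle : `|w| <= C1 * D.
  have [w0|/eqP wN0] := eqVneq w 0; first by rewrite w0 normr0 mulr_ge0.
  have wgt : 0 < `|w| by rewrite normr_gt0; exact/eqP.
  pose t := Num.min ((r - `|y - x|) / (2 * `|w|)) (2 * (L + 1) * `|w|)^-1.
  have L1 : 0 < L + 1 by rewrite ltr_wpDl.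
  have t0 : 0 < t by rewrite lt_min invr_gt0 divr_gt0 ?subr_gt0 ?mulr_gt0.
  have t1 : t * (2 * `|w|) <= r - `|y - x|.
    by rewrite -ler_pdivlMr ?mulr_gt0// ge_min lexx.
  have t2 : t * (2 * (L + 1) * `|w|) <= 1.
    by rewrite -ler_pdivlMr ?mulr_gt0// div1r ge_min lexx orbT.
  have yw : `|y + t *: w - x| < r.
    rewrite addrAC (le_lt_trans (ler_normD _ _))// normrZ (gtr0_norm t0).
    by have := mulr_gt0 t0 wgt; lra.
  have [lip _ _ /(_ w)] := est _ _ yr yw.
  have e : y + t *: w - y = t *: w by rewrite addrAC subrr add0r.
  rewrite distrC (distrC y) e normrZ (gtr0_norm t0) in lip.
  rewrite e dotZr normrZ (gtr0_norm t0).
  set S := \sum_j _ => Htay.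
  have SB : `|S| <= N * (L * (t * `|w|)) * ((1 + N * k * L * L) * D).
    apply: (le_trans (ler_norm_sum _ _ _)).
    have -> : N * (L * (t * `|w|)) * ((1 + N * k * L * L) * D) =
        \sum_(j < n) ((L * (t * `|w|)) * ((1 + N * k * L * L) * D)).
      by rewrite sumr_const card_ord -mulr_natl -/N; ring.
    apply: ler_sum => j _; rewrite normrM; apply: ler_pM => //.
    exact: le_trans (coord_le_norm _ _) lip.
  have n2 := norm_le_dot w.
  have tn2 := ler_wpM2l (ltW t0) n2.
  have Htay2 : t * dot w w <= S + L * `|w| * (t * `|w|) ^+ 2.
    by move: Htay; rewrite ler_norml => /andP[_ ?]; lra.
  have S2 := le_trans (ler_norm S) SB.
  have key : (t * `|w|) * `|w| <=
      (t * `|w|) * (N * L * ((1 + N * k * L * L) * D) + L * `|w| * (t * `|w|)) by lra.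
  rewrite ler_pM2l ?mulr_gt0// in key.
  have q : L * `|w| * (t * `|w|) <= `|w| / 2.
    have := ler_wpM2r (ltW wgt) t2; have := mulr_gt0 (mulr_gt0 t0 wgt) wgt; lra.
  rewrite /C1; lra.
rewrite extendB; apply: norm_extend_le => /=.
  by apply: (le_trans wle); rewrite ler_wpM2r// lerDl mulr_ge0.
have -> : dot y y - dot y' y' = dot (y - y') (y + y').
  by rewrite !(dotBl, dotDr) (dotC y' y); ring.
apply: (le_trans (dot_le_norm _ _)); rewrite -/N.
have yy : `|y + y'| <= 2 * (`|x| + r).
  apply: (le_trans (ler_normD _ _)).
  have b u : `|u - x| < r -> `|u| <= `|x| + r.
    move=> ur; have := ler_normD (u - x) x; rewrite subrK; lra.
  by have := b _ yr; have := b _ yr'; lra.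
have st : N * `|y - y'| * `|y + y'| <= N * (L * D) * (2 * (`|x| + r)).
  by apply: ler_pM; rewrite ?mulr_ge0// ler_wpM2l.
by apply: (le_trans st); have := mulr_ge0 C10 D0; rewrite /B; lra.
Qed.

Lemma conormal_image_no_ball v0 (s0 : R) : 0 < s0 -> exists2 v, `|v - v0| < s0 &
  forall nu x, prox_normal M nu x -> extend nu (dot x x) <> v.
Proof.
move=> s00.
pose P (X : set 'rV[R]_n) := forall k : R, 0 <= k -> thin (conormal_image X k).
have [||x Mx|B [PB MB]] := @countable_cover R n M P.
- move=> k _; apply: (@thinS _ _ _ set0); last exact: thin0.
  by move=> _ [p [/= []]].
- move=> X Y XY PY k k0; apply: (thinS _ (PY k k0)).
  by move=> _ [p [/= Xp ? ?] <-]; exists p => //; split => //; exact: XY.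
- exact: conormal_image_locally_thin.
pose E j := if unpickle j is Some (i, k) then conormal_image (B i) (k%:R : R) else set0.
have [|v vv0 vE] := @thin_union_no_ball _ _ E v0 s0 _ s00.
  by move=> j; rewrite /E; case: unpickle => [[i k]|]; [exact: PB|exact: thin0].
exists v => // nu x px vx; have [Mx _] := px.
have [j _ Bjx] := MB _ Mx.
apply: (vE (pickle (j, Num.bound `|nu|))); rewrite /E pickleK.
exists (nu, x) => //; split => //=; apply: ltW; exact: archi_boundP.
Qed.

End ConormalImage.

(** * Zeros of polynomials *)

(* R[X_0]...[X_(m-1)] as iterated univariate polynomials. *)
Fixpoint npoly (R : idomainType) (m : nat) : idomainType :=
  if m is m'.+1 then {poly npoly R m'} : idomainType else R.

Fixpoint npeval (R : idomainType) (m : nat) (e : nat -> R) : {rmorphism npoly R m -> R} :=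
  match m return {rmorphism npoly R m -> R} with
  | 0 => (idfun : {rmorphism R -> R})
  | m'.+1 => (horner_eval (e m') \o map_poly (npeval m' e)
              : {rmorphism {poly npoly R m'} -> R})
  end.

Section NestedPolynomials.
Variable R : realType.
Local Notation NP := (npoly R).

Lemma npevalS m (e : nat -> R) (p : NP m.+1) :
  npeval m.+1 e p = (map_poly (npeval m e) p).[e m].
Proof. by []. Qed.

Lemma npevalC m (e : nat -> R) (c : NP m) : npeval m.+1 e (c%:P : NP m.+1) = npeval m e c.
Proof. by rewrite npevalS map_polyC hornerC. Qed.

Lemma npevalX m (e : nat -> R) : npeval m.+1 e ('X : NP m.+1) = e m.
Proof. by rewrite npevalS map_polyX hornerX. Qed.

Lemma eq_npeval m (e e' : nat -> R) : (forall i, (i < m)%N -> e i = e' i) ->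
  npeval m e =1 npeval m e'.
Proof.
elim: m => [//|m IH] ee' p; rewrite !npevalS ee'//.
by rewrite (eq_map_poly (IH _))// => i im; apply: ee'; exact: ltnW.
Qed.

Fixpoint npvar m i : NP m :=
  if m is m'.+1 then (if i == m' then 'X else (npvar m' i)%:P) else 0.

Lemma npeval_var m (e : nat -> R) i : npeval m e (npvar m i) = if (i < m)%N then e i else 0.
Proof.
elim: m => [|m IH]; first by rewrite rmorph0.
rewrite [npvar _ _]/=; case: eqVneq => [->|im]; first by rewrite npevalX ltnS leqnn.
by rewrite npevalC IH [(i < m.+1)%N]ltnS [(i <= m)%N]leq_eqVlt (negPf im).
Qed.

Fixpoint npconst m (c : R) : NP m :=
  match m return NP m with 0 => c | m'.+1 => (npconst m' c)%:P end.

Lemma npeval_const m (e : nat -> R) c : npeval m e (npconst m c) = c.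
Proof. by elim: m => [//|m IH]; rewrite [npconst _ _]/= npevalC. Qed.

(** The padding by 0 agrees with the default value of [nth], so that formulas in [env v] and
    polynomials at [coords v] read the same variables. *)
Definition coords n (v : 'rV[R]_n) (i : nat) : R := oapp (fun j => v 0 j) 0 (insub i).

Lemma coordsE n (v : 'rV[R]_n) (i : 'I_n) : coords v i = v 0 i.
Proof. by rewrite /coords valK. Qed.

Lemma coords_out n (v : 'rV[R]_n) i : (n <= i)%N -> coords v i = 0.
Proof. by move=> ni; rewrite /coords insubF// ltnNge ni. Qed.

Lemma coordsB n (v w : 'rV[R]_n) i : coords v i - coords w i = coords (v - w) i.
Proof.
by rewrite /coords; case: insubP => [j _ _|_] /=; rewrite ?mxE ?subrr.
Qed.

Lemma coords_le n (v : 'rV[R]_n) i : `|coords v i| <= `|v|.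
Proof.
rewrite /coords; case: insubP => [j _ _|_] /=; first exact: coord_le_norm.
by rewrite normr0.
Qed.

(** * Local Lipschitz continuity of polynomial functions *)

Definition locally_lipschitz n (f : 'rV[R]_n -> R) := forall x, exists r L : R,
  [/\ 0 < r, 0 <= L & forall y z, `|y - x| < r -> `|z - x| < r ->
      `|f y - f z| <= L * `|y - z|].

Lemma locally_lipschitzD n (f g : 'rV[R]_n -> R) : locally_lipschitz f ->
  locally_lipschitz g -> locally_lipschitz (fun v => f v + g v).
Proof.
move=> lf lg x; have [r [L [r0 L0 H]]] := lf x; have [r' [L' [r'0 L'0 H']]] := lg x.
exists (Num.min r r'), (L + L'); split; [by rewrite lt_min r0|exact: addr_ge0|].
move=> y z; rewrite !lt_min => /andP[y1 y2] /andP[z1 z2].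
rewrite opprD addrACA mulrDl (le_trans (ler_normD _ _))//.
by apply: lerD; [exact: H|exact: H'].
Qed.

Lemma locally_lipschitz_bound n (f : 'rV[R]_n -> R) x : locally_lipschitz f ->
  exists r B : R, [/\ 0 < r, 0 <= B & forall y, `|y - x| < r -> `|f y| <= B].
Proof.
move=> lf; have [r [L [r0 L0 H]]] := lf x.
exists r, (`|f x| + L * r); split => //; first by rewrite addr_ge0// mulr_ge0// ltW.
move=> y yr; have xx : `|x - x| < r by rewrite subrr normr0.
have -> : f y = f x + (f y - f x) by rewrite addrC subrK.
rewrite (le_trans (ler_normD _ _))// lerD2l (le_trans (H _ _ yr xx))//.
by rewrite ler_wpM2l// ltW.
Qed.

Lemma locally_lipschitzM n (f g : 'rV[R]_n -> R) : locally_lipschitz f ->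
  locally_lipschitz g -> locally_lipschitz (fun v => f v * g v).
Proof.
move=> lf lg x; have [r [L [r0 L0 H]]] := lf x; have [r' [L' [r'0 L'0 H']]] := lg x.
have [s [B [s0 B0 fB]]] := locally_lipschitz_bound x lf.
have [s' [B' [s'0 B'0 gB]]] := locally_lipschitz_bound x lg.
exists (Num.min (Num.min r r') (Num.min s s')), (B * L' + L * B').
split; [by rewrite !lt_min r0 r'0 s0|by rewrite addr_ge0// mulr_ge0|].
move=> y z; rewrite !lt_min => /andP[/andP[y1 y2] /andP[y3 y4]].
move=> /andP[/andP[z1 z2] /andP[z3 z4]].
have -> : f y * g y - f z * g z = f y * (g y - g z) + (f y - f z) * g z by ring.
rewrite [(B * L' + _) * _]mulrDl (le_trans (ler_normD _ _))// !normrM; apply: lerD.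
  by rewrite -mulrA; apply: ler_pM => //; [exact: fB|exact: H'].
by rewrite mulrAC; apply: ler_pM => //; [exact: H|exact: gB].
Qed.

Lemma locally_lipschitz_cst n (c : R) : locally_lipschitz (fun _ : 'rV[R]_n => c).
Proof. by move=> x; exists 1, 0; split => // y z _ _; rewrite subrr normr0 mul0r. Qed.

Lemma npeval_lipschitz n m (p : NP m) :
  locally_lipschitz (fun v : 'rV[R]_n => npeval m (coords v) p).
Proof.
elim: m p => [|m IH] p; first exact: locally_lipschitz_cst.
elim/poly_ind: p => [|p c IHp].
  rewrite (_ : (fun v => _) = fun=> 0); first exact: locally_lipschitz_cst.
  by apply/funext => v; rewrite rmorph0.
rewrite (_ : (fun v => _) = fun v : 'rV[R]_n =>
    npeval m.+1 (coords v) p * coords v m + npeval m (coords v) c); last first.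
  by apply/funext => v; rewrite rmorphD rmorphM npevalX npevalC.
apply: locally_lipschitzD => //; apply: locally_lipschitzM => //.
move=> x; exists 1, 1; split => // y z _ _.
by rewrite mul1r coordsB coords_le.
Qed.

Lemma locally_lipschitz_continuous n (f : 'rV[R]_n -> R) :
  locally_lipschitz f -> continuous f.
Proof.
move=> lf x; apply/continuous_atP => e e0; have [r [L [r0 L0 H]]] := lf x.
have L1 : 0 < L + 1 by rewrite ltr_wpDl.
exists (Num.min r (e / (L + 1))); first by rewrite lt_min r0 divr_gt0.
move=> y; rewrite lt_min ltr_pdivlMr// => /andP[yr ye].
have xx : `|x - x| < r by rewrite subrr normr0.
rewrite (le_lt_trans (H _ _ xx _))//; first by rewrite distrC.
by have := normr_ge0 (x - y); lra.
Qed.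

(** * Zero sets of nonzero polynomials *)

Definition countably_thin n (A : set 'rV[R]_n) :=
  exists E : nat -> set 'rV[R]_n, (forall j, thin (E j)) /\ A `<=` \bigcup_j E j.

Lemma countably_thinU n (A B : set 'rV[R]_n) :
  countably_thin A -> countably_thin B -> countably_thin (A `|` B).
Proof.
move=> [E [tE AE]] [F [tF BF]].
exists (fun j => if odd j then E j./2 else F j./2); split.
  by move=> j; case: odd.
move=> x [/AE[j _ Ej]|/BF[j _ Fj]].
  by exists j.*2.+1 => //=; rewrite odd_double /= uphalf_double.
by exists j.*2 => //; rewrite odd_double doubleK.
Qed.

Lemma countably_thinS n (A B : set 'rV[R]_n) : A `<=` B ->
  countably_thin B -> countably_thin A.
Proof. by move=> AB [E [tE BE]]; exists E; split => // x /AB /BE. Qed.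

(* Where its derivative in the last variable does not vanish, a zero set is
   locally the graph of a Lipschitz function of the other variables. *)
Lemma regular_zeros_thin n m (p : NP m.+1) : (m < n)%N ->
  countably_thin [set v : 'rV[R]_n | npeval m.+1 (coords v) p = 0 /\
    npeval m.+1 (coords v) (p^`() : NP m.+1) <> 0].
Proof.
case: n => // k mk; set X := (X in countably_thin X).
pose i0 : 'I_k.+1 := Ordinal mk.
pose g v := npeval m.+1 (coords (v : 'rV[R]_k.+1)) p.
pose g' v := npeval m.+1 (coords (v : 'rV[R]_k.+1)) (p^`() : NP m.+1).
suff [B [tB XB]] : exists B : nat -> set 'rV[R]_k.+1,
    (forall j, thin (B j `&` X)) /\ X `<=` \bigcup_j B j.
  exists (fun j => B j `&` X); split => // x Xx.
  by have [j _ Bx] := XB _ Xx; exists j.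
apply: (@countable_cover _ _ X (fun B => thin (B `&` X))).
- by rewrite set0I; exact: thin0.
- by move=> A B AB; apply: thinS => x [/AB].
move=> x [gx g'x].
have [r [L [r0 L0 H]]] := npeval_lipschitz p x.
have c0 : 0 < `|g' x| / 2 by rewrite divr_gt0// normr_gt0; exact/eqP.
set c := `|g' x| / 2 in c0.
have g'c := locally_lipschitz_continuous (npeval_lipschitz (p^`() : NP m.+1)).
have [s s0 Hs] := (continuous_atP _ _).1 (g'c _ x) _ c0.
have g'far y : `|y - x| < s -> c <= `|g' y|.
  rewrite distrC => /Hs; rewrite -/(g' x) -/(g' y).
  have := lerB_dist (g' x) (g' y); rewrite /c; lra.
exists (Num.min r s); first by rewrite lt_min r0.
pose drop (v : 'rV[R]_k.+1) : 'rV[R]_k := \row_j v 0 (lift i0 j).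
have -> : [set y | `|y - x| < Num.min r s] `&` X =
    id @` ([set y | `|y - x| < Num.min r s] `&` X) by rewrite image_id.
apply: (@thin_lipschitz _ _ _ _ _ drop (`|x| + r) (1 + L / c)).
  move=> y [/= + _]; rewrite lt_min => /andP[yr _].
  apply: norm_le_coord => [|j]; first by rewrite addr_ge0// ltW.
  rewrite mxE (le_trans (coord_le_norm _ _))//.
  have := ler_normD x (y - x); rewrite addrC subrK; lra.
move=> y z [/= yr [gy _]] [/= zr [gz _]].
set D := `|drop y - drop z|.
have dD j : `|(y - z) 0 (lift i0 j)| <= D.
  by have := coord_le_norm (drop y - drop z) j; rewrite !mxE.
have D0 : 0 <= D by exact: normr_ge0.
(* This is z with coordinate m replaced by t. A sup-norm ball is a box, so such mixtures of y and z
   stay in it. *)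
pose set_m (t : R) : 'rV[R]_k.+1 := \row_j if j == i0 then t else z 0 j.
have set_ball t : Num.min (y 0 i0) (z 0 i0) <= t <= Num.max (y 0 i0) (z 0 i0) ->
    `|set_m t - x| < Num.min r s.
  move=> /andP[t1 t2]; apply: norm_lt_coord => [|j]; first by rewrite lt_min r0.
  rewrite !mxE; have zj := le_lt_trans (coord_le_norm (z - x) j) zr.
  have yj := le_lt_trans (coord_le_norm (y - x) j) yr.
  rewrite !mxE in zj yj; case: eqVneq => [ji|//]; rewrite ji in zj yj *.
  move: zj yj t1 t2; set e := Num.min r s.
  rewrite !ltr_norml /Num.min /Num.max; case: ifP => _ /andP[? ?] /andP[? ?] ? ?;
  by apply/andP; split; lra.
pose P := map_poly (npeval m (coords z)) p.
have evalP t q : npeval m.+1 (coords (set_m t)) (q : NP m.+1) =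
    (map_poly (npeval m (coords z)) q).[t].
  rewrite npevalS; have -> : coords (set_m t) m = t.
    by have := coordsE (set_m t) i0; rewrite mxE eqxx.
  congr (_.[_]); apply: eq_map_poly; apply: eq_npeval => i im.
  have ik : (i < k.+1)%N := ltn_trans im mk.
  have := coordsE (set_m t) (Ordinal ik); have := coordsE z (Ordinal ik) => /= -> ->.
  by rewrite mxE -val_eqE /= (ltn_eqF im).
have setz : set_m (z 0 i0) = z by apply/rowP => j; rewrite mxE; case: eqVneq => [->|].
(* As P vanishes at z_m, this bounds c |y_m - z_m| by |P(y_m)|, which is the difference of the
   values of p at [set_m (y 0 i0)] and at its zero y, two points with the same coordinate m. *)
have mv : exists2 t, Num.min (y 0 i0) (z 0 i0) <= t <= Num.max (y 0 i0) (z 0 i0) &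
    P.[y 0 i0] - P.[z 0 i0] = P^`().[t] * (y 0 i0 - z 0 i0).
  have [yz|zy|->] := ltgtP (y 0 i0) (z 0 i0).
  - have [t + e] := poly_mvt P yz; rewrite in_itv /= => /andP[t1 t2].
    by exists t; rewrite ?(ltW t1) ?(ltW t2)//; lra.
  - have [t + e] := poly_mvt P zy; rewrite in_itv /= => /andP[t1 t2].
    by exists t; rewrite ?(ltW t1) ?(ltW t2)//; lra.
  - by exists (z 0 i0); rewrite ?lexx// !subrr mulr0.
have [t tin tP] := mv.
have tb := set_ball t tin.
have yin : Num.min (y 0 i0) (z 0 i0) <= y 0 i0 <= Num.max (y 0 i0) (z 0 i0).
  by rewrite ge_min lexx le_max lexx.
have yb := set_ball _ yin.
have yD : `|set_m (y 0 i0) - y| <= D.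
  apply: norm_le_coord => // j; rewrite !mxE; case: eqVneq => [->|ji].
    by rewrite subrr normr0.
  have [j' ->|ji'] := unliftP i0 j; last by rewrite ji' eqxx in ji.
  by rewrite distrC; have := dD j'; rewrite !mxE.
move: (tb) yb yr zr; rewrite !lt_min => /andP[_ ts] /andP[ybr _] /andP[yr _] /andP[zr _].
have := H _ _ ybr yr; rewrite evalP gy subr0 => HL.
have Pz : P.[z 0 i0] = 0 by rewrite /P -evalP setz.
rewrite Pz subr0 in tP.
have := g'far _ ts; rewrite /g' evalP -deriv_map => g't.
have ic : `|y 0 i0 - z 0 i0| <= L / c * D.
  rewrite mulrAC ler_pdivlMr//.
  have h1 : c * `|y 0 i0 - z 0 i0| <= `|P.[y 0 i0]|.
    by rewrite tP normrM ler_wpM2r.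
  have := ler_wpM2l L0 yD; rewrite mulrC; lra.
have Lc : 0 <= L / c * D by rewrite mulr_ge0// divr_ge0// ltW.
apply: norm_le_coord => [|j]; first by rewrite mulr_ge0// addr_ge0// divr_ge0// ltW.
rewrite mulrDl mul1r; have [j' ->|->] := unliftP i0 j.
  by apply: (le_trans (dD j')); rewrite lerDl.
by rewrite !mxE (le_trans ic)// lerDr.
Qed.

Lemma npoly_natr_neq0 m k : k.+1%:R != 0 :> NP m.
Proof.
apply/eqP => /(congr1 (npeval m (fun=> 0))); rewrite rmorph_nat rmorph0 => /eqP.
by rewrite pnatr_eq0.
Qed.

(** Induction on the number of variables, then on the degree in the last one. A zero of p is regular
    or a zero of the derivative, which is nonzero and of smaller degree because the characteristic
    is 0; if p is constant in the last variable, it has fewer variables. *)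
Lemma zeros_countably_thin n m (p : NP m) : (m <= n)%N -> p != 0 ->
  countably_thin [set v : 'rV[R]_n | npeval m (coords v) p = 0].
Proof.
elim: m p => [|m IH] p mn p0.
  exists (fun=> set0); split=> [j|v /= pv]; first exact: thin0.
  by move/eqP: p0.
have [N] := ubnP (size (p : {poly NP m})); elim: N p p0 => // N IHN p p0 sN.
have [s1|s1] := leqP (size (p : {poly NP m})) 1.
  have pc := size1_polyC s1.
  have c0 : (p : {poly NP m})`_0 != 0.
    by apply: contra_neq p0 => c0; rewrite pc c0.
  apply: countably_thinS (IH _ (ltnW mn) c0) => v pv.
  change (npeval m (coords v) (p : {poly NP m})`_0 = 0).
  by rewrite -npevalC -pc.
have p'0 : (p^`() : NP m.+1) != 0.
  have [s e] : exists s, size (p : {poly NP m}) = s.+2.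
    by case: (size _) s1 => [|[|s]]//; exists s.
  apply/eqP => /(congr1 (fun q : {poly NP m} => q`_s)); rewrite coef_deriv coef0.
  rewrite -mulr_natr => /eqP; rewrite mulf_eq0 (negPf (npoly_natr_neq0 _ _)) orbF.
  by have := p0; rewrite -lead_coef_eq0 lead_coefE e /= => /negPf->.
have := IHN _ p'0; move=> /(_ _)/countably_thinU -/(_ _ _ (regular_zeros_thin p mn)) H.
apply: (countably_thinS _ (H _)).
  move=> v pv; have [e|/eqP ?] := eqVneq (npeval m.+1 (coords v) (p^`() : NP m.+1)) 0.
    by left.
  by right.
by rewrite ltnS in sN; apply: leq_trans sN; exact: lt_size_deriv.
Qed.

Lemma zeros_null n (p : NP n) : p != 0 ->
  lebesgue_null [set v : 'rV[R]_n | npeval n (coords v) p = 0].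
Proof.
by move=> p0; have [E [tE XE]] := zeros_countably_thin (leqnn n) p0; exact: thin_union_null XE.
Qed.

(* Cauchy's bound on the roots is locally bounded off the zeros of the leading
   coefficient. *)
Lemma roots_locally_bounded n (Q : {poly NP n}) (v : 'rV[R]_n) :
  npeval n (coords v) (lead_coef Q) != 0 ->
  exists r B : R, 0 < r /\ forall w (s : R), `|w - v| < r ->
    (map_poly (npeval n (coords w)) Q).[s] = 0 -> s <= B.
Proof.
move=> lQ.
pose lc w : R := npeval n (coords (w : 'rV[R]_n)) (lead_coef Q).
pose c := `|lc v| / 2; have c0 : 0 < c by rewrite divr_gt0// normr_gt0.
have lcc := locally_lipschitz_continuous (npeval_lipschitz (lead_coef Q)).
have [s s0 Hs] := (continuous_atP _ _).1 (lcc _ v) _ c0.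
have lcfar w : `|w - v| < s -> c <= `|lc w|.
  rewrite distrC => /Hs; rewrite -/(lc v) -/(lc w).
  have := lerB_dist (lc v) (lc w); rewrite /c; lra.
have [r [B [r0 B0 HB]]] : exists r L : R, [/\ 0 < r, 0 <= L &
    forall (j : 'I_(size Q)) w, `|w - v| < r -> `|npeval n (coords w) Q`_j| <= L].
  apply: fin_common => [j a a' b b' /andP[_ aa'] bb' H w wa|j].
    by apply: le_trans bb'; apply: H; exact: lt_le_trans aa'.
  exact: (locally_lipschitz_bound v (npeval_lipschitz _)).
exists (Num.min r s), (1 + c^-1 * \sum_(i < size Q) B).
split=> [|w t]; first by rewrite lt_min r0.
rewrite lt_min => /andP[wr ws] Qt.
have lw : lc w != 0 by rewrite -normr_gt0 (lt_le_trans c0)// lcfar.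
have sQ : size (map_poly (npeval n (coords w)) Q) = size Q by exact: size_map_poly_id0.
have Q0 : map_poly (npeval n (coords w)) Q != 0.
  rewrite -size_poly_eq0 sQ size_poly_eq0; apply: contra_neq lw => Q0.
  by rewrite /lc Q0 lead_coef0 rmorph0.
apply: (le_trans (ler_norm _)); apply: ltW; apply: (lt_le_trans (cauchy_boundP Q0 Qt)).
rewrite /cauchy_bound lead_coef_map_id0 ?rmorph0// sQ lerD2l.
apply: ler_pM; rewrite ?invr_ge0 ?sumr_ge0//.
  by rewrite lef_pV2 ?posrE ?normr_gt0// lcfar.
by apply: ler_sum => i _; rewrite coef_map; exact: HB.
Qed.

End NestedPolynomials.

(** * Quantifier elimination *)

Section QuantifierElimination.
Variable R : realType.
Local Notation term := (GRing.term R).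
Local Notation formula := (ord.formula R).

Lemma quantifier_elimination (f : formula) : exists g : formula,
  ord.qf_form g && ord.rformula g /\ forall e, ord.holds e f <-> ord.qf_eval e g.
Proof.
exists (ord.quantifier_elim (fun i s => @wproj R i s) (ord.to_rform f)); split.
  apply: (ord.quantifier_elim_wf (@wf_QE_wproj R)).
  exact: ord.to_rform_rformula.
by move=> e; exact: (rwP (rcf_satP e f)).
Qed.

(** Inverses get the junk value 0; [rterm] excludes them in [npeval_term]. *)
Fixpoint npterm m (t : term) : npoly R m :=
  match t with
  | GRing.Var i => npvar R m i
  | GRing.Const c => npconst m c
  | GRing.NatConst k => k%:R
  | GRing.Add t1 t2 => npterm m t1 + npterm m t2
  | GRing.Opp t1 => - npterm m t1
  | GRing.NatMul t1 k => npterm m t1 *+ k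
  | GRing.Mul t1 t2 => npterm m t1 * npterm m t2
  | GRing.Inv _ => 0
  | GRing.Exp t1 k => npterm m t1 ^+ k
  end.

Definition env n (v : 'rV[R]_n) : seq R := mkseq (coords v) n.

Lemma nth_env n (v : 'rV[R]_n) i : (env v)`_i = coords v i.
Proof.
have [iN|Ni] := ltnP i n; first by rewrite nth_mkseq.
by rewrite nth_default ?size_mkseq// coords_out.
Qed.

Lemma npeval_term n (v : 'rV[R]_n) t : GRing.rterm t ->
  npeval n (coords v) (npterm n t) = GRing.eval (env v) t.
Proof.
elim: t => //=.
- move=> i _; rewrite npeval_var nth_env; case: ltnP => // ni.
  by rewrite coords_out.
- by move=> c _; rewrite npeval_const.
- by move=> k _; rewrite rmorph_nat.
- by move=> t1 IH1 t2 IH2 /andP[r1 r2]; rewrite rmorphD IH1// IH2.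
- by move=> t IH r; rewrite rmorphN IH.
- by move=> t IH k r; rewrite rmorphMn IH.
- by move=> t1 IH1 t2 IH2 /andP[r1 r2]; rewrite rmorphM IH1// IH2.
- by move=> t IH k r; rewrite rmorphXn IH.
Qed.

Lemma sign_locally_constant n (g : 'rV[R]_n -> R) v : locally_lipschitz g -> g v != 0 ->
  exists2 r : R, 0 < r & forall w, `|w - v| < r -> 0 < g v * g w.
Proof.
move=> lg gv; have g0 : 0 < `|g v| by rewrite normr_gt0.
have gc := locally_lipschitz_continuous lg.
have [r r0 H] := (continuous_atP _ _).1 (gc v) _ g0.
exists r => // w; rewrite distrC => /H.
have -> : g v * g w = g v ^+ 2 - g v * (g v - g w) by ring.
move=> lt; rewrite subr_gt0 (le_lt_trans (ler_norm _))// normrM.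
by rewrite -real_normK ?num_real// expr2 ltr_pM2l.
Qed.

Definition locally_constant n (Q : npoly R n) (b : 'rV[R]_n -> bool) :=
  forall v, npeval n (coords v) Q != 0 ->
    exists2 r : R, 0 < r & forall w, `|w - v| < r -> b w = b v.

Lemma locally_constant2 n (Q1 Q2 : npoly R n) b1 b2 (op : bool -> bool -> bool) :
  locally_constant Q1 b1 -> locally_constant Q2 b2 ->
  locally_constant (Q1 * Q2) (fun v => op (b1 v) (b2 v)).
Proof.
move=> H1 H2 v; rewrite rmorphM mulf_eq0 negb_or => /andP[/H1[r1 r10 {}H1] /H2[r2 r20 {}H2]].
exists (Num.min r1 r2); first by rewrite lt_min r10.
by move=> w; rewrite lt_min => /andP[/H1-> /H2->].
Qed.

(** The condition [c] sees only the sign, and a polynomial keeps its sign near a point where it is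
    nonzero. If the difference of the terms is the zero polynomial, the truth value is constant and
    1 serves as [Q]. *)
Lemma sign_condition n (t1 t2 : term) (c : R -> bool) :
  GRing.rterm t1 -> GRing.rterm t2 ->
  (forall x y, 0 < x * y -> c x = c y) ->
  exists2 Q : npoly R n, Q != 0 & locally_constant Q
    (fun v => c (GRing.eval (env v) t1 - GRing.eval (env v) t2)).
Proof.
move=> r1 r2 cs; pose P := npterm n t1 - npterm n t2.
have PE (v : 'rV[R]_n) : GRing.eval (env v) t1 - GRing.eval (env v) t2 = npeval n (coords v) P.
  by rewrite /P rmorphB !npeval_term.
have [P0|P0] := eqVneq P 0.
  exists 1; first exact: oner_neq0.
  by move=> v _; exists 1 => // w _; rewrite !PE P0 !rmorph0.
exists P => // v Pv.
have [r r0 H] := sign_locally_constant (npeval_lipschitz P) Pv.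
by exists r => // w /H /cs; rewrite !PE.
Qed.

Lemma qf_locally_constant n (f : formula) : ord.qf_form f && ord.rformula f ->
  exists2 Q : npoly R n, Q != 0 & locally_constant Q (fun v => ord.qf_eval (env v) f).
Proof.
elim: f => //=.
- move=> b _; exists 1; first exact: oner_neq0.
  by move=> v _; exists 1.
- move=> t1 t2 /andP[r1 r2].
  have [|Q Q0 H] := @sign_condition n t1 t2 (fun x => x == 0) r1 r2.
    move=> x y xy; apply/eqP/eqP => e0; move: xy; rewrite e0 ?mul0r ?mulr0 ltxx//.
  by exists Q => // v /H[r r0 {}H]; exists r => // w /H; rewrite !subr_eq0.
- move=> t1 t2 /andP[r1 r2].
  have [|Q Q0 H] := @sign_condition n t1 t2 (fun x => x < 0) r1 r2.
    by move=> x y xy; apply/idP/idP; nra.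
  by exists Q => // v /H[r r0 {}H]; exists r => // w /H; rewrite !subr_lt0.
- move=> t1 t2 /andP[r1 r2].
  have [|Q Q0 H] := @sign_condition n t1 t2 (fun x => x <= 0) r1 r2.
    by move=> x y xy; apply/idP/idP; nra.
  by exists Q => // v /H[r r0 {}H]; exists r => // w /H; rewrite !subr_le0.
- move=> f1 IH1 f2 IH2; rewrite andbACA => /andP[/IH1[Q1 Q10 H1] /IH2[Q2 Q20 H2]].
  by exists (Q1 * Q2); [rewrite mulf_neq0|exact: (locally_constant2 andb H1 H2)].
- move=> f1 IH1 f2 IH2; rewrite andbACA => /andP[/IH1[Q1 Q10 H1] /IH2[Q2 Q20 H2]].
  by exists (Q1 * Q2); [rewrite mulf_neq0|exact: (locally_constant2 orb H1 H2)].
- move=> f1 IH1 f2 IH2; rewrite andbACA => /andP[/IH1[Q1 Q10 H1] /IH2[Q2 Q20 H2]].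
  by exists (Q1 * Q2); [rewrite mulf_neq0|exact: (locally_constant2 implb H1 H2)].
- move=> f IH /IH[Q Q0 H]; exists Q => // v /H[r r0 {}H].
  by exists r => // w /H->.
Qed.

(* A semialgebraic set is, off the zeros of a nonzero polynomial, open. *)
Lemma definable_sub_zeros n (f : formula) (S : set 'rV[R]_n) :
  (forall v, S v -> ord.holds (env v) f) ->
  (forall (v : 'rV[R]_n) (r : R), 0 < r ->
    exists2 w, `|w - v| < r & ~ ord.holds (env w) f) ->
  exists2 Q : npoly R n, Q != 0 & forall v, S v -> npeval n (coords v) Q = 0.
Proof.
move=> Sf noball; have [g [gqf fg]] := quantifier_elimination f.
have [Q Q0 H] := qf_locally_constant n gqf.
exists Q => // v /Sf/fg gv; apply/eqP; apply: contrapT => /negP/H[r r0 {}H].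
have [w /H wv] := noball v _ r0; apply; apply/fg; by rewrite wv.
Qed.

(** * A first-order formula for the conormal image *)

Fixpoint update (s k : nat) (x : nat -> R) (e : seq R) : seq R :=
  if k is k'.+1 then update s k' x (set_nth 0 e (s + k') (x k')) else e.

Lemma nth_update s k x e i :
  (update s k x e)`_i = if (s <= i < s + k)%N then x (i - s)%N else e`_i.
Proof.
elim: k e => [|k IH] e /=; first by rewrite addn0; case: leqP => //= si; rewrite ltnNge si.
rewrite IH nth_set_nth /= addnS ltnS.
have [si|si] /= := leqP s i; last by case: eqP => // ei; move: si; rewrite ei ltnNge leq_addr.
have [ik|ik] /= := ltnP i (s + k); first by rewrite ltnW.
by rewrite eqn_leq ik andbT; case: leqP => // ik'; congr x; lia.
Qed.

(** The last variable of the block is bound outermost, matching the order of the assignments in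
    [update]. *)
Fixpoint exists_block (s k : nat) (f : formula) : formula :=
  if k is k'.+1 then ord.Exists (s + k') (exists_block s k' f) else f.

Lemma eq_update s k x y e : (forall i, (i < k)%N -> x i = y i) ->
  update s k x e = update s k y e.
Proof.
elim: k e => //= k IH e xy; rewrite xy//; apply: IH => i ik; apply: xy.
exact: ltnW.
Qed.

Lemma holds_exists_block s k f e :
  ord.holds e (exists_block s k f) <-> exists x, ord.holds (update s k x e) f.
Proof.
elim: k e => [|k IH] e /=; first by split=> [H|[]//]; exists (fun=> 0).
split=> [[a /IH[x H]]|[x H]]; last by exists (x k); apply/IH; exists x.
exists (fun i => if i == k then a else x i); rewrite eqxx.
rewrite (@eq_update _ _ _ x)// => i ik; by rewrite (ltn_eqF ik).
Qed.

Definition tsum (ts : seq term) : term := foldr (@GRing.Add R) (GRing.NatConst R 0) ts.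

Lemma eval_tsum e ts : GRing.eval e (tsum ts) = \sum_(t <- ts) GRing.eval e t.
Proof. by elim: ts => [|t ts IH]; rewrite ?big_nil//= big_cons IH. Qed.

Definition tprod (ts : seq term) : term := foldr (@GRing.Mul R) (GRing.NatConst R 1) ts.

Lemma eval_tprod e ts : GRing.eval e (tprod ts) = \prod_(t <- ts) GRing.eval e t.
Proof. by elim: ts => [|t ts IH]; rewrite ?big_nil//= big_cons IH. Qed.

Definition tmpoly n (s : nat) (p : mpoly n R) : term :=
  tsum [seq GRing.Mul (GRing.Const (mcoeff m p))
    (tprod [seq GRing.Exp (GRing.Var R (s + nat_of_ord i)) (fun_of_multinom m i)
           | i <- enum 'I_n]) | m <- msupp p].

Lemma eval_tmpoly n s (p : mpoly n R) e :
  GRing.eval e (tmpoly s p) = meval (fun i => e`_(s + i)) p.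
Proof.
rewrite eval_tsum big_map mevalE; apply: eq_bigr => m _ /=.
by rewrite eval_tprod big_map big_enum.
Qed.

Definition fzeros n (s : nat) (ps : seq (mpoly n R)) : formula :=
  foldr (fun p f => ord.And (ord.Equal (tmpoly s p) (GRing.NatConst R 0)) f)
    (ord.Bool true) ps.

Lemma holds_fzeros n s (ps : seq (mpoly n R)) e (v : 'rV[R]_n) :
  (forall i : 'I_n, e`_(s + i) = v 0 i) ->
  ord.holds e (fzeros s ps) <-> all (fun p => meval (fun i => v 0 i) p == 0) ps.
Proof.
move=> ev; elim: ps => //= p ps IH; rewrite eval_tmpoly (meval_eq p ev).
by rewrite IH; split=> [[-> ->]|/andP[/eqP-> ->]]//; rewrite eqxx.
Qed.

Definition tdot n (a b : 'I_n -> term) : term := tsum [seq GRing.Mul (a i) (b i) | i <- enum 'I_n].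

Lemma eval_tdot n (a b : 'I_n -> term) e (u v : 'rV[R]_n) :
  (forall i, GRing.eval e (a i) = u 0 i) -> (forall i, GRing.eval e (b i) = v 0 i) ->
  GRing.eval e (tdot a b) = dot u v.
Proof.
move=> au bv; rewrite eval_tsum big_map big_enum; apply: eq_bigr => i _ /=.
by rewrite au bv.
Qed.

Let tvar n s (i : 'I_n) : term := GRing.Var R (s + i).
Let tsub n (a b : 'I_n -> term) i : term := GRing.Add (a i) (GRing.Opp (b i)).

Definition fprox n (ps : seq (mpoly n R)) (nu x y : 'I_n -> term) (s k : nat) : formula :=
  ord.Implies (fzeros s ps) (ord.Le (GRing.NatConst R 0)
    (GRing.Add (tdot nu (tsub y x))
       (GRing.Mul (GRing.Var R k) (tdot (tsub y x) (tsub y x))))).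

Lemma holds_fprox n (ps : seq (mpoly n R)) s k e (nu x y : 'rV[R]_n) (tnu tx : 'I_n -> term) :
  (forall i, GRing.eval e (tnu i) = nu 0 i) ->
  (forall i, GRing.eval e (tx i) = x 0 i) ->
  (forall i, GRing.eval e (tvar s i) = y 0 i) ->
  ord.holds e (fprox ps tnu tx (tvar s) s k) <->
  (all (fun p => meval (fun i => y 0 i) p == 0) ps ->
   0 <= dot nu (y - x) + e`_k * dot (y - x) (y - x)).
Proof.
move=> h1 h2 h3.
have h4 i : GRing.eval e (tsub (tvar s) tx i) = (y - x) 0 i.
  by have := h2 i; have := h3 i; rewrite /= => -> ->; rewrite !mxE.
rewrite -(eval_tdot h1 h4) -(eval_tdot h4 h4); have Z := holds_fzeros ps h3.
by split=> H /Z; exact: H.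
Qed.

(* The variables are nu (0 .. n-1), |x|^2 (n), x (n+1 .. 2n), C (2n+1) and
   y (2n+2 .. 3n+1). *)
Definition fconormal n (ps : seq (mpoly n R)) : formula :=
  let nu := tvar (n := n) 0 in let x := tvar (n := n) n.+1 in
  let y := tvar (n := n) (n.+1 + n).+1 in
  exists_block n.+1 n (ord.And (fzeros n.+1 ps) (ord.And
    (ord.Equal (tdot x x) (GRing.Var R n))
    (ord.Exists (n.+1 + n) (ord.Not (exists_block (n.+1 + n).+1 n
      (ord.Not (fprox ps nu x y (n.+1 + n).+1 (n.+1 + n)))))))).

Lemma coords_extend n (nu : 'rV[R]_n) (s : R) i : (i < n)%N ->
  coords (extend nu s) i = coords nu i.
Proof.
move=> iN; have iN1 : (i < n.+1)%N by exact: ltnW.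
have -> : coords (extend nu s) i = extend nu s 0 (Ordinal iN1).
  exact: (coordsE (extend nu s) (Ordinal iN1)).
have -> : Ordinal iN1 = lift ord_max (Ordinal iN).
  by apply: val_inj; rewrite /= /bump leqNgt iN.
by rewrite extend_lift; exact: (esym (coordsE nu (Ordinal iN))).
Qed.

Lemma coords_extend_last n (nu : 'rV[R]_n) (s : R) : coords (extend nu s) n = s.
Proof. by rewrite (coordsE (extend nu s) ord_max) extend_max. Qed.

Lemma holds_fconormal n (M : set 'rV[R]_n) (ps : seq (mpoly n R)) nu (s : R) :
  M = [set x | all (fun p => meval (fun i => x 0 i) p == 0) ps] ->
  ord.holds (env (extend nu s)) (fconormal ps) <->
  exists2 x, prox_normal M nu x & dot x x = s.
Proof.
move=> ME; have Mps x : M x <-> all (fun p => meval (fun i => x 0 i) p == 0) ps.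
  by rewrite ME.
set e := env _.
have row_coords (x : nat -> R) i : (\row_(j < n) x j) 0 i = x i by rewrite mxE.
have xvar (x : nat -> R) (i : 'I_n) :
    (update n.+1 n x e)`_(n.+1 + i) = (\row_(j < n) x j) 0 i.
  by rewrite nth_update leq_addr ltn_add2l ltn_ord mxE addKn.
have svar (x : nat -> R) : (update n.+1 n x e)`_n = s.
  by rewrite nth_update ltnn /= nth_env coords_extend_last.
have inner (x y : nat -> R) (C : R) :
  let e' := update (n.+1 + n).+1 n y (set_nth 0 (update n.+1 n x e) (n.+1 + n) C) in
  [/\ forall i : 'I_n, GRing.eval e' (tvar 0 i) = nu 0 i,
      forall i : 'I_n, GRing.eval e' (tvar n.+1 i) = (\row_(j < n) x j) 0 i,
      forall i : 'I_n, GRing.eval e' (tvar (n.+1 + n).+1 i) = (\row_(j < n) y j) 0 i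
    & e'`_(n.+1 + n) = C].
  move=> e'; split=> [i|i|i|] /=.
  - rewrite nth_update nth_set_nth /= nth_update.
    have iN := ltn_ord i.
    rewrite !ifF; try lia.
    by rewrite nth_env add0n coords_extend// coordsE.
  - rewrite nth_update nth_set_nth /=; have iN := ltn_ord i.
    rewrite ifF; last by lia.
    rewrite ifF; last by lia.
    exact: xvar.
  - rewrite nth_update ifT; last by have := ltn_ord i; lia.
    by rewrite mxE addKn.
  - by rewrite nth_update ltnn /= nth_set_nth /= eqxx.
have body (x y : nat -> R) (C : R) :
  let e' := update (n.+1 + n).+1 n y (set_nth 0 (update n.+1 n x e) (n.+1 + n) C) in
  let X := \row_(j < n) x j in let Y := \row_(j < n) y j in
  ord.holds e' (fprox ps (tvar 0) (tvar n.+1) (tvar (n.+1 + n).+1) (n.+1 + n).+1 (n.+1 + n))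
  <-> (M Y -> 0 <= dot nu (Y - X) + C * dot (Y - X) (Y - X)).
  move=> e' X Y; have [h1 h2 h3 h4] := inner x y C.
  by rewrite (holds_fprox ps _ h1 h2 h3) h4 Mps.
rewrite /fconormal holds_exists_block; split.
- move=> [x /= [/(holds_fzeros _ (xvar x))/Mps Mx [xx [C H]]]].
  exists (\row_(j < n) x j); last first.
    by rewrite -(eval_tdot (a := tvar n.+1) (b := tvar n.+1) (xvar x) (xvar x)) xx svar.
  (* The quantifier over y is encoded as not-exists-not, hence the classical reasoning. *)
  split=> //; exists C => y My; apply: contrapT => Hy; apply: H.
  apply/holds_exists_block; exists (coords y) => /(body x (coords y) C).
  have -> : \row_(j < n) coords y j = y by apply/rowP => j; rewrite mxE coordsE.
  by move=> /(_ My).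
- move=> [x [Mx [C H]] xx].
  have rx : \row_(j < n) coords x j = x by apply/rowP => j; rewrite mxE coordsE.
  exists (coords x); split.
    by apply/(holds_fzeros _ (xvar (coords x))); rewrite rx; apply/Mps.
  split.
    have E := eval_tdot (a := tvar n.+1) (b := tvar n.+1) (xvar (coords x)) (xvar (coords x)).
    by rewrite rx xx -{1}(svar (coords x)) in E; exact: E.
  exists C => /holds_exists_block[y] /=; apply; apply/(body (coords x) y C).
  by rewrite rx; exact: H.
Qed.

End QuantifierElimination.

(* The squared norm of the feet of the proximal normals close to nu is bounded,
   unless nu is a zero of the leading coefficient of the polynomial that
   vanishes on the pairs (nu, |x|^2). *)
Lemma generic_prox_normal_bounded (R : realType) (n d : nat) (M : set 'rV[R]_n) :
  submanifold d M -> algebraic_set M -> exists2 q : npoly R n, q != 0 &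
    forall nu, npeval n (coords nu) q != 0 -> exists r B : R, 0 < r /\
      forall nu' x, `|nu' - nu| < r -> prox_normal M nu' x -> dot x x <= B.
Proof.
move=> sM [ps ME].
have [||Q Q0 QG] := @definable_sub_zeros R n.+1 (fconormal ps)
  [set v | exists nu x, prox_normal M nu x /\ v = extend nu (dot x x)].
- by move=> _ [nu [x [px ->]]]; apply/(holds_fconormal _ _ ME); exists x.
- move=> v r r0; have [w wv H] := conormal_image_no_ball sM v r0.
  exists w => //.
  have -> : w = extend (\row_j w 0 (lift ord_max j)) (w 0 ord_max).
    by apply/rowP => i; rewrite !mxE; case: unliftP => [j ->|->]; rewrite ?mxE.
  move=> /(holds_fconormal _ _ ME)[x px xx]; apply: (H _ _ px).
  apply/rowP => i; rewrite !mxE; case: unliftP => [j ->|->]; rewrite ?mxE//.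
exists (lead_coef (Q : {poly npoly R n})); first by rewrite lead_coef_eq0.
move=> nu /roots_locally_bounded[r [B [r0 H]]]; exists r, B; split => // nu' x nur px.
apply: (H nu' _ nur).
have : npeval n.+1 (coords (extend nu' (dot x x))) Q = 0 by apply: QG; exists nu', x.
rewrite npevalS coords_extend_last => <-; congr (_.[_]); apply: eq_map_poly.
by apply: eq_npeval => i iN; rewrite coords_extend.
Qed.

(** * The theorem *)

Lemma lebesgue_nullS (R : realType) n (A B : set 'rV[R]_n) : A `<=` B ->
  lebesgue_null B -> lebesgue_null A.
Proof.
move=> AB nB e e0; have [D [l [u [H1 H2 H3]]]] := nB e e0.
by exists D, l, u; split => //; exact: subset_trans H2.
Qed.

(** Along a curve c in M through p, the proximal inequality at c(h) reads 0 <= h F(h), where F(h)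
    tends to nu . v. So F is nonnegative for small h > 0 and nonpositive for small h < 0, and its
    limit vanishes. *)
Lemma prox_normal_tangent (R : realType) n (M : set 'rV[R]_n) nu p v :
  prox_normal M nu p -> tangent_space M p v -> dot nu v = 0.
Proof.
move=> [Mp [C HC]] [e [c [e0 sc Mc c0 Dc]]].
have [dc _] := sc 1%N.
have in0 : (0 : R) \in `]-e, e[ by rewrite in_itv /= oppr_lt0 e0.
have cvq : (fun h : R => h^-1 *: (c h - p)) @ 0^' --> v.
  have : derivable c 0 1 by apply: diff_derivable; exact: dc.
  rewrite -Dc => /cvgP; rewrite /derivable /derive c0.
  rewrite (_ : (fun h : R => h^-1 *: ((c \o shift 0) (h *: 1) - p)) =
    (fun h : R => h^-1 *: (c h - p)))//.
  by apply/funext => h /=; rewrite addr0 [h *: 1]mulr1.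
pose F (h : R) := dot nu (h^-1 *: (c h - p)) +
  C * (h * dot (h^-1 *: (c h - p)) (h^-1 *: (c h - p))).
have cF : F @ 0^' --> dot nu v.
  rewrite -[X in _ --> X]addr0; apply: cvgD.
    exact: (continuous_cvg _ (@dot_continuous _ _ nu v) cvq).
  rewrite -[X in _ --> X](mulr0 C); apply: cvgMr.
  rewrite -[X in _ --> X](mul0r (dot v v)); apply: cvgM.
    exact: cvg_within.
  have := @dist_continuous _ _ 0 v; rewrite (_ : (fun q => _) = fun q => dot q q).
    by move=> dcv; exact: (continuous_cvg _ dcv cvq).
  by apply/funext => q; rewrite subr0.
apply: contrapT => /eqP m0.
have vgt0 : 0 < `|dot nu v| by rewrite normr_gt0.
move/cvgrPdist_lt: cF => /(_ _ vgt0).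
move=> /nbhs_ballP[d /= d0 H].
(* F(s) >= 0 >= F(- s) cannot both be closer to nu . v than |nu . v|. *)
pose s := Num.min (d / 2) (e / 2).
have s0 : 0 < s by rewrite lt_min !divr_gt0.
have sd : s < d by rewrite (@le_lt_trans _ _ (d / 2)) ?ge_min ?lexx//; lra.
have se : s < e by rewrite (@le_lt_trans _ _ (e / 2)) ?ge_min ?lexx ?orbT//; lra.
have key h : h != 0 -> `|h| < d -> `|h| < e -> 0 <= h * F h /\ `|dot nu v - F h| < `|dot nu v|.
  move=> hN0 hd he; split; last first.
    by apply: (H h) => //; rewrite -ball_normE /= sub0r normrN.
  have hin : h \in `]-e, e[ by rewrite in_itv /= -ltr_norml.
  have := HC _ (Mc _ hin); rewrite /F.
  have e1 : c h - p = h *: (h^-1 *: (c h - p)) by rewrite scalerA mulfV// scale1r.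
  rewrite {1 2 3}e1; set w := h^-1 *: _.
  by rewrite !(dotZl, dotZr) => /le_trans; apply; lra.
have := key s; rewrite gt_eqF// gtr0_norm// => /(_ isT sd se)[h1 h2].
have := key (- s); rewrite oppr_eq0 gt_eqF// normrN gtr0_norm// => /(_ isT sd se)[h3 h4].
rewrite pmulr_rge0// in h1; rewrite mulNr oppr_ge0 pmulr_rle0// in h3.
move: h2 h4; rewrite !ltr_norml; case: (lerP 0 (dot nu v)) => hm.
  by rewrite ger0_norm// => /andP[? ?] /andP[? ?]; lra.
by rewrite ltr0_norm// => /andP[? ?] /andP[? ?]; lra.
Qed.

(** Contrapositively, the absence of critical values in [a, b] yields the hypothesis [ncrit] of the
    deformation. *)
Lemma prox_normal_critical (R : realType) n (M : set 'rV[R]_n)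
    (f : {linear 'rV[R]_n -> R^o}) p :
  prox_normal M (functional_coords f) p -> critical_point f M p.
Proof.
move=> pn; split=> [|v tv]; first by case: pn.
have fE : f = dot (functional_coords f) :> ('rV[R]_n -> R^o).
  by apply/funext => u; exact: linear_dot.
rewrite diff_lin; last by rewrite fE; exact: dot_continuous.
by rewrite linear_dot; exact: (prox_normal_tangent pn tv).
Qed.

Theorem theorem2p2p1 (R : realType) (n d : nat) (M : set 'rV[R]_n) :
  closed_algebraic_submanifold d M ->
  generic_functional (fun f : {linear 'rV[R]_n -> R^o} =>
    forall a b : R, a <= b ->
      (forall c : R, critical_value f M c -> c \notin `[a, b]) ->
      homotopy_equivalent R (sublevel f M a) (sublevel f M b)).
Proof.
move=> [cM aM sM].
have [q q0 Hq] := generic_prox_normal_bounded sM aM.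
exists [set f | npeval n (coords (functional_coords f)) q = 0]; split.
  apply: lebesgue_nullS (zeros_null q0).
  by move=> _ [f fq <-].
move=> f /eqP/Hq[r [B [r0 rB]]] a b ab ncrit.
have subE c : sublevel f M c = [set x | M x /\ dot (functional_coords f) x <= c].
  by apply/seteqP; split=> x; rewrite /sublevel /= linear_dot.
rewrite !subE; apply: (sublevels_homotopy_equivalent cM ab _ r0 rB).
  by move=> x Mx; exact: (unique_near sM Mx).
move=> y My yab /prox_normal_critical crit.
have := ncrit (f y) (ex_intro2 _ _ y crit erefl).
by rewrite in_itv /= linear_dot yab.
Qed.
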